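(* Let $g:\mathbb R\to\mathbb R$ be locally Lipschitz and such that the ODE $\dot x=g(x)$ generates a semi-flow $\Phi:\mathbb R\times\mathbb R_+\to\mathbb R$. Let $\lambda>0$, let $\nu$ be a probability distribution on $\mathbb R$, and let $h:\mathbb R\to\mathbb R$ be bounded and increasing. Suppose there exist $a,b$ in the support of $\nu$ with $b-a>\sup h-\inf h$. Then the log income process $(X_t)_{t\ge0}$ with drift, determined by $(g,\lambda,\nu,h)$ and with transition probability function $(P_t)_{t\ge0}$, is globally stable: there exists a unique stationary distribution $\phi^*$ and $$\lim_{t\to\infty}\beta(\phi P_t,\phi^* )=0\quad\text{for all }\phi\in\mathcal P(\mathbb R).$$
   Context: $\Phi(x,t)$ is the value at time $t$ of the solution of $\dot x=g(x)$ started at $x$ (defined for all $t\ge0$). Log income process with drift. Let $(E_n)_{n\ge1}$ be iid $\mathrm{Exp}(\lambda)$ (rate $\lambda$), $(\zeta_n)_{n\ge1}$ iid from $\nu$, with these sequences and $X_0$ independent. Put $Z_0=X_0$, $Z_{n+1}=h(\Phi(Z_n,E_{n+1}))+\zeta_{n+1}$, $T_0=0$, $T_n=\sum_{i=1}^nE_i$, $N_t=\max\{n\ge0:T_n\le t\}$, and $X_t=\Phi(Z_{N_t},t-T_{N_t})$. (That is, the state follows the ODE between jumps arriving at rate $\lambda$, and a jump moves it from $x$ to $h(x)+\zeta$.) The transition probability function is $P_t(x,B)=\mathbb P\{X_t\in B\mid X_0=x\}$, and $(\phi P_t)(B)=\int P_t(x,B)\phi(dx)$. A stationary distribution is a $\phi^*\in\mathcal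 P(\mathbb R)$ with $\phi^*P_t=\phi^*$ for all $t\ge0$. $\mathcal P(\mathbb R)$ is the set of Borel probability measures on $\mathbb R$, and $\beta(\phi,\psi)=\sup|\int f\,d\phi-\int f\,d\psi|$ with the supremum over increasing (nondecreasing) functions $f:\mathbb R\to\mathbb R$ with $|f|\le1$. ''Increasing'' means nondecreasing throughout. *)

(* Defs.v *)
From HB Require Import structures.
From mathcomp Require Import all_boot all_order all_algebra.
From mathcomp Require Import all_classical all_reals all_analysis.

Set Implicit Arguments.
Unset Strict Implicit.
Unset Printing Implicit Defensive.

Import Order.TTheory GRing.Theory Num.Theory.
Import numFieldNormedType.Exports.

Local Open Scope classical_set_scope.
Local Open Scope ring_scope.

Definition locally_lipschitz (R : realType) (g : R -> R) : Prop :=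
  forall x : R, exists2 U : set R, nbhs x U & [lipschitz g y | y in U].

(* [u] solves u' = g(u) on [0, +oo[, with a right derivative at 0; the values
   of [u] at negative times are irrelevant. *)
Definition ode_solution (R : realType) (g : R -> R) (u : R -> R) : Prop :=
  (s^-1 * (u s - u 0) @[s --> (0 : R)^'+] --> g (u 0)) /\
  (forall t : R, 0 < t -> is_derive t 1 u (g (u t))).

(* The semigroup law is not listed: for locally Lipschitz [g] it follows from
   uniqueness of solutions. *)
Definition semiflow_of (R : realType) (g : R -> R) (Phi : R -> R -> R) : Prop :=
  forall x, Phi x 0 = x /\ ode_solution g (Phi x).

Section laws.
Context {R : realType}.

Definition msupport (nu : probability R R) : set R :=
  [set x | forall U, open_nbhs x U -> (0 < nu U)%E].

Definition mutually_independent {d} {Omega : measurableType d}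
    (P : probability Omega R) (I : eqType) (X : I -> {RV P >-> R}) : Prop :=
  forall (s : seq I) (B : I -> set R), uniq s ->
    (forall i, measurable (B i)) ->
    P (\big[setI/setT]_(i <- s) (X i @^-1` B i)) =
    (\prod_(i <- s) P (X i @^-1` B i))%E.

(* [beta] and the operators below are defined on bare set functions, because
   [right_action Pt t phi] is not a priori bundled as a measure. *)
Definition beta (phi psi : set R -> \bar R) : \bar R :=
  ereal_sup [set `| \int[phi]_x (f x)%:E - \int[psi]_x (f x)%:E |%E | f in
    [set f : R -> R | {homo f : x y / x <= y} /\ forall x, `|f x| <= 1]].

Definition right_action (Pt : R -> R -> set R -> \bar R) (t : R)
    (phi : set R -> \bar R) : set R -> \bar R :=
  fun B => (\int[phi]_x Pt t x B)%E.

Definition stationary (Pt : R -> R -> set R -> \bar R) (phi : probability R R) :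
    Prop :=
  forall t, 0 <= t ->
  forall B, measurable B -> right_action Pt t phi B = phi B.

(* Uniqueness is on Borel sets: the values of a [probability] elsewhere carry no
   meaning. *)
Definition globally_stable (Pt : R -> R -> set R -> \bar R) : Prop :=
  exists phis : probability R R,
    [/\ stationary Pt phis,
        forall psi : probability R R, stationary Pt psi ->
          forall B, measurable B -> psi B = phis B
      & forall phi : probability R R,
          beta (right_action Pt t phi) phis @[t --> +oo] --> 0%E].

End laws.

Section log_income_process.
Context {R : realType} {d} {Omega : measurableType d} {P : probability Omega R}.

(* [E n] and [zeta n] stand for E_{n+1} and zeta_{n+1}. The waiting times are
   taken pointwise nonnegative since the semi-flow is only meaningful at times
   in [0, +oo[. *)
Record income_driver (lambda : R) (nu : probability R R)
    (E zeta : nat -> {RV P >-> R}) : Prop := IncomeDriver {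
  waiting_ge0 : forall n w, 0 <= E n w;
  waiting_law : forall n B, measurable B ->
    distribution P (E n) B = exponential_prob lambda B;
  shock_law : forall n B, measurable B -> distribution P (zeta n) B = nu B;
  driver_independent : mutually_independent
    (fun i : nat + nat => match i with inl n => E n | inr n => zeta n end)
}.

Variables (Phi : R -> R -> R) (h : R -> R) (E zeta : nat -> Omega -> R).

Fixpoint jump_state (X0 : Omega -> R) (n : nat) (w : Omega) : R :=
  if n is m.+1 then h (Phi (jump_state X0 m w) (E m w)) + zeta m w else X0 w.

Definition jump_time (n : nat) (w : Omega) : R := \sum_(i < n) E i w.

(* The maximum of {n | T_n <= t}, with default 0 when there is none (which for
   t >= 0 only happens on the null event that T_n <= t for all n). *)
Definition jump_count (t : R) (w : Omega) : nat :=
  xget 0%N [set n | jump_time n w <= t /\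
                    forall m, jump_time m w <= t -> (m <= n)%N].

Definition log_income (X0 : Omega -> R) (t : R) (w : Omega) : R :=
  let N := jump_count t w in Phi (jump_state X0 N w) (t - jump_time N w).

(* Conditioning on X_0 = x amounts to starting at the constant x, as X_0 is
   independent of [E] and [zeta]. *)
Definition income_transition (t x : R) (B : set R) : \bar R :=
  P (log_income (cst x) t @^-1` B).

End log_income_process.

Arguments income_transition {R d Omega} P Phi h E zeta t x B.

(* Main.v *)
Require Import Defs.
From HB Require Import structures.
From mathcomp Require Import all_boot all_order all_algebra.
From mathcomp Require Import all_classical all_reals all_analysis.
From mathcomp Require Import measurable_realfun ring lra.

Set Implicit Arguments.
Unset Strict Implicit.
Unset Printing Implicit Defensive.

Import Order.TTheory GRing.Theory Num.Theory.
Import numFieldNormedType.Exports.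

Local Open Scope classical_set_scope.
Local Open Scope ring_scope.

(** Write [P_t f (x)] for the expectation of [f (X_t)] given [X_0 = x]. The
    transition operators preserve increasing functions, and the proof shows that
    they contract the oscillation of such a function geometrically, uniformly in
    the function. Everything else follows from this.

    _Monotonicity._ Solutions of a locally Lipschitz equation do not cross
    ([ode_solution_le]), so the flow is increasing in its starting point; so is
    [h], and hence so is each path as a function of its starting point, the
    waiting times and shocks being kept fixed.

    _Contraction._ Let [f] be increasing with [l <= f <= l + c]. A jump moves [x]
    to [h x + zeta], which lies between [inf h + zeta] and [sup h + zeta]. Since
    the support of [nu] is wider than the range of [h], there is a level [z0] such
    that with positive probability [sup h + zeta <= z0], and with positive
    probability [z0 <= inf h + zeta]. In the first case [f] is at most [f z0]
    after the jump, in the second at least [f z0], wherever the jump starts. Thus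
    averaging over the shock multiplies the oscillation by a factor less than 1
    ([shock_contraction]). A jump occurs before time 1 with positive probability,
    so [P_1] contracts oscillations by some [k < 1] ([income_op_contract]), and by
    the semigroup law all [P_t f] with [t >= n] take their values in one common
    interval of length [k ^ n] ([income_op_ergodic]).

    _Semigroup law._ The pairs (state after the [n]-th jump, time left until [t])
    form a homogeneous Markov chain whose one-step operator is [jump_op]. By
    independence of the driver, [P_t f (x)] is the sum over [n] of the [n]-th
    iterate of [jump_op], applied to the contribution of the paths that do not
    jump any more ([integral_log_income]). This series solves the renewal equation
    obtained by conditioning on the first jump ([income_opE]), which has only one
    bounded solution ([income_op_unique]). As the exponential law is memoryless,
    [P_(s + t) f] and [P_s (P_t f)] solve the same renewal equation in [s], so they
    are equal ([income_op_semigroup]).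

    _Conclusion._ For the indicator of a ray, [P_n f] converges at the rate
    [k ^ n], uniformly in the ray and in the starting point. Hence the distribution
    functions of [X_n] converge uniformly, and their limit is the distribution
    function of a probability [phis] ([exists_limit_law]). By the layer-cake
    formula the convergence on rays extends to increasing functions
    ([le_integral_homo]), in particular to [P_t f], and the semigroup law gives
    stationarity ([limit_law_stationary]). If [psi] is stationary, the integral of
    an increasing [f] against [psi] is the integral of [P_n f] for every [n], hence
    it is the limit of [P_n f]: this gives uniqueness, and the convergence in
    [beta] at the rate [k ^ n] ([beta_le]). *)

(** * The flow of a locally Lipschitz equation *)

Section ode.
Variables (R : realType) (g : R -> R).
Implicit Types (u v : R -> R).

Lemma ode_solution_right_continuous u : ode_solution g u ->
  forall t, 0 <= t -> u s @[s --> t^'+] --> u t.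
Proof.
move=> [u0 du] t; rewrite le_eqVlt => /predU1P[<-|t0]; last first.
  apply: cvg_at_right_filter; apply/differentiable_continuous.
  by apply/derivable1_diffP; case: (du _ t0).
have: (fun s => s * (s^-1 * (u s - u 0)) + u 0) s @[s --> 0^'+] --> 0 * g (u 0) + u 0.
  apply: cvgD; last exact: cvg_cst.
  by apply: cvgM => //; apply: cvg_at_right_filter; exact: cvg_id.
rewrite mul0r add0r; apply: cvg_trans; apply: near_eq_cvg.
near=> s; rewrite /= mulrA divff ?mul1r ?subrK// gt_eqF//.
Unshelve. all: by end_near. Qed.

Lemma ode_solution_continuous u : ode_solution g u ->
  forall t, 0 < t -> {for t, continuous u}.
Proof.
move=> [_ du] t t0; apply/differentiable_continuous.
by apply/derivable1_diffP; case: (du _ t0).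
Qed.

Lemma ode_solution_within u a b : ode_solution g u -> 0 <= a -> a < b ->
  {within `[a, b], continuous u}.
Proof.
move=> hu a0 ab; apply/continuous_within_itvP => //; split.
- move=> x; rewrite in_itv/= => /andP[ax _].
  by apply: ode_solution_continuous => //; exact: le_lt_trans ax.
- exact: ode_solution_right_continuous.
- apply: cvg_at_left_filter; apply: ode_solution_continuous => //.
  exact: le_lt_trans ab.
Qed.

Lemma ode_solution_shift u s : 0 <= s -> ode_solution g u ->
  ode_solution g (fun t => u (s + t)).
Proof.
move=> s0 hu; have [u0 du] := hu; split; last first.
  move=> t t0; have st : 0 < s + t by rewrite ltr_wpDl.
  have := du _ st => d.
  have d' : is_derive t (1:R) (fun t : R => s + t) 1.
    have := is_deriveD (is_derive_cst s t 1) (is_derive_id t (1 : R)).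
    by rewrite add0r.
  by have := is_derive1_comp d d'; rewrite mulr1.
rewrite addr0; move: s0; rewrite le_eqVlt => /predU1P[<-|s0].
  by under eq_fun do rewrite add0r.
have [dv <-] := du _ s0.
have := cvg_dnbhs_at_right dv.
apply: cvg_trans; apply: near_eq_cvg; near=> h.
by rewrite /= /GRing.scale/= mulr1 [h + s]addrC.
Unshelve. all: by end_near. Qed.

Hypothesis g_lip : locally_lipschitz g.

(** Two solutions cannot cross: if [u - v] became positive, it would do so just
    after a last time [t0] at which it vanishes; there [(u - v)' <= k (u - v)]
    by the Lipschitz condition, so by the mean value theorem the maximum of
    [u - v] over [`[t0, t0 + e]] is at most [k * e] times itself, which is
    impossible as soon as [k * e < 1]. *)
Lemma ode_solution_le u v : ode_solution g u -> ode_solution g v ->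
  u 0 <= v 0 -> forall t, 0 <= t -> u t <= v t.
Proof.
move=> hu hv uv0 t1 t1_ge0; rewrite leNgt; apply/negP => vu1.
pose S := [set s | 0 <= s <= t1 /\ u s <= v s].
have S0 : S 0 by split; rewrite ?lexx.
have supS : has_sup S by split; [exists 0|exists t1 => s [/andP[]]].
set t0 := sup S.
have S_le s : S s -> s <= t0 := fun Ss => ub_le_sup (proj2 supS) Ss.
have t0_ge0 : 0 <= t0 by exact: S_le.
have t0_le : t0 <= t1 by apply: ge_sup; [exists 0|move=> s [/andP[]]].
pose w s := u s - v s.
have w_gt0 s : t0 < s -> s <= t1 -> 0 < w s.
  move=> ts st; rewrite subr_gt0 ltNge; apply/negP => uvs.
  have : s <= t0.
    by apply: S_le; split => //; rewrite st (le_trans t0_ge0 (ltW ts)).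
  by rewrite leNgt ts.
have w0_le0 : w t0 <= 0.
  rewrite leNgt; apply/negP => wt0.
  have t0_gt0 : 0 < t0.
    rewrite lt_neqAle t0_ge0 andbT; apply/negP => /eqP t0E.
    by move: wt0; rewrite -t0E subr_gt0 ltNge uv0.
  have cw : {for t0, continuous w}.
    by apply: continuousB; exact: ode_solution_continuous.
  have nw : \forall s \near t0, 0 < w s by exact: (cvgr_gt _ cw).
  have [e /= e0 he] := nw.
  have [s Ss ts] := sup_adherent e0 supS; have [_ uvs] := Ss.
  have st : s <= t0 by exact: S_le.
  have : 0 < w s.
    by apply: he; rewrite /ball/= ger0_norm ?subr_ge0// ltrBlDl -ltrBlDr.
  by rewrite subr_gt0 ltNge uvs.
have t0_lt : t0 < t1.
  rewrite lt_neqAle t0_le andbT; apply/negP => /eqP t0E.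
  by move: w0_le0; rewrite t0E subr_le0 leNgt vu1.
have rw : w s @[s --> t0^'+] --> w t0.
  by apply: cvgB; exact: ode_solution_right_continuous.
have w0 : w t0 = 0.
  apply/eqP; rewrite eq_le w0_le0/=.
  apply: (cvgr_to_ge rw); near=> s; apply/ltW/w_gt0 => //.
  by near: s; exact: nbhs_right_le.
have uv : u t0 = v t0 by apply/eqP; rewrite -subr_eq0; apply/eqP.
have [U nU [k0 [_ hk0]]] := g_lip (u t0).
pose k := Num.max k0 0 + 1.
have k_gt0 : 0 < k by rewrite ltr_wpDl ?le_max ?lexx ?orbT.
have hk y z : U y -> U z -> `|g y - g z| <= k * `|y - z|.
  move=> Uy Uz; apply: (hk0 k _ (y, z)) => //.
  by rewrite (@le_lt_trans _ _ (Num.max k0 0)) ?le_max ?lexx// ltrDl.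
have nUu : \forall s \near t0^'+, U (u s).
  exact: (ode_solution_right_continuous hu t0_ge0 nU).
have nUv : \forall s \near t0^'+, U (v s).
  by apply: (ode_solution_right_continuous hv t0_ge0); rewrite -uv.
have [e /= e0 he] := filterI nUu nUv.
(* [c] keeps [t0 + c] below [t1], both solutions in [U], and [k * c < 1] *)
pose c := Num.min (t1 - t0) (Num.min (e / 2) (k^-1 / 2)).
have c_gt0 : 0 < c by rewrite !lt_min subr_gt0 t0_lt !divr_gt0 ?invr_gt0.
have ct1 : t0 + c <= t1 by rewrite -lerBrDl ge_min lexx.
have ce : c < e.
  by rewrite (@le_lt_trans _ _ (e / 2)) ?gtr_pMr ?invf_lt1 ?ltr1n// !ge_min lexx orbT.
have ck : k * c < 1.
  rewrite mulrC -ltr_pdivlMr// (@le_lt_trans _ _ (k^-1 / 2)) ?mul1r//.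
    by rewrite !ge_min lexx !orbT.
  by rewrite gtr_pMr ?invr_gt0// invf_lt1 ?ltr1n.
have tc : t0 < t0 + c by rewrite ltrDl.
have wc a b : t0 <= a -> a < b -> {within `[a, b], continuous w}.
  move=> ta ab x; have a0 := le_trans t0_ge0 ta.
  by apply: cvgB; apply: ode_solution_within.
have [m] := EVT_max (ltW tc) (wc _ _ (lexx _) tc).
rewrite in_itv/= => /andP[tm mc] hm.
have wm_gt0 : 0 < w m.
  apply: (@lt_le_trans _ _ (w (t0 + c))); first exact: w_gt0.
  by apply: hm; rewrite in_itv/= lexx ltW.
have tm' : t0 < m.
  by rewrite lt_neqAle tm andbT; apply: contraTneq wm_gt0 => <-; rewrite w0 ltxx.
have dw x : x \in `]t0, m[ -> is_derive x 1 w (g (u x) - g (v x)).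
  rewrite in_itv/= => /andP[tx _]; have x0 : 0 < x by exact: le_lt_trans tx.
  by apply: is_deriveB; [exact: (proj2 hu)|exact: (proj2 hv)].
have [x] := MVT tm' dw (wc _ _ (lexx _) tm').
rewrite in_itv/= => /andP[tx xm]; rewrite w0 subr0 => wmE.
have xc : x - t0 < c by rewrite ltrBlDl (lt_le_trans xm).
have [Uu Uv] : U (u x) /\ U (v x).
  apply: he => //; rewrite /ball/= ltr0_norm ?subr_lt0// opprB.
  exact: lt_trans ce.
have wx : w x <= w m.
  by apply: hm; rewrite in_itv/= !ltW//; exact: lt_le_trans xm mc.
have : w m <= k * w m * c.
  have mc' : m - t0 <= c by rewrite lerBlDl.
  rewrite {1}wmE (@le_trans _ _ (k * w m * (m - t0)))//; last first.
    by rewrite ler_pM2l ?mulr_gt0.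
  rewrite ler_pM2r ?subr_gt0//.
  apply: le_trans (ler_norm _) _.
  apply: le_trans (hk _ _ Uu Uv) _.
  rewrite ler_pM2l// ger0_norm// ltW// w_gt0//.
  exact: le_trans (ltW xm) (le_trans mc ct1).
by rewrite mulrAC leNgt gtr_pMl ?ck.
Unshelve. all: by end_near. Qed.

End ode.

(** The right-continuity in time makes [F] a pointwise limit of functions that
    take countably many values in the second variable, so that joint
    measurability reduces to measurability in the first one. *)
Lemma measurable_fun_right_continuous d (T : measurableType d) (R : realType)
    (F : T -> R -> R) :
  (forall t, 0 <= t -> measurable_fun setT (F ^~ t)) ->
  (forall x t, 0 <= t -> F x s @[s --> t^'+] --> F x t) ->
  measurable_fun setT (fun p : T * R => F p.1 (Num.max p.2 0)).
Proof.
move=> mF rF.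
pose k (n : nat) (t : R) := Num.truncn (Num.max t 0 * n.+1%:R).
pose F_ (n : nat) (p : T * R) := F p.1 ((k n p.2).+1%:R / n.+1%:R).
apply: (@measurable_fun_cvg _ _ _ _ F_) => [n|[x t] _].
- move=> _ B mB; rewrite setTI.
  rewrite [X in measurable X](_ : _ = \bigcup_(j : nat)
      ((F ^~ (j.+1%:R / n.+1%:R) @^-1` B) `*` [set t | k n t = j])).
    apply: bigcup_measurable => j _; apply: measurableX.
      by rewrite -[X in measurable X]setTI; apply: mF => //; rewrite divr_ge0.
    have -> : [set t | k n t = j] =
        (fun t : R => Num.max t 0 * n.+1%:R) @^-1` `[j%:R, j.+1%:R[.
      apply/seteqP; split => t /=; rewrite in_itv/=.
        by move=> <-; apply: truncn_itv; rewrite mulr_ge0// le_max lexx orbT.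
      by move=> /truncn_def.
    rewrite -[X in measurable X]setTI.
    have : measurable_fun setT (fun t : R => Num.max t 0 * n.+1%:R).
      apply: measurable_funM => //; exact: measurable_maxr.
    by apply.
  apply/seteqP; split => [[x t]/= ?|[x t] [j _ [/= + kj]]]; first by exists (k n t).
  by rewrite -kj.
- have t0 : 0 <= Num.max t 0 by rewrite le_max lexx orbT.
  move/cvg_at_rightP : (rF x _ t0); apply; split.
    move=> n; rewrite ltr_pdivlMr//.
    by have /andP[] := truncn_itv (mulr_ge0 t0 (ler0n _ n.+1)).
  apply: (@squeeze_cvgr _ _ _ _ (cst (Num.max t 0))
    (fun n => Num.max t 0 + n.+1%:R^-1) _ _ (Num.max t 0)).
  + near=> n; rewrite /=; apply/andP; split.
      rewrite ler_pdivlMr// ltW//.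
      by have /andP[] := truncn_itv (mulr_ge0 t0 (ler0n _ n.+1)).
    rewrite ler_pdivrMr// mulrDl mulVf// -natr1 lerD2r.
    by have /andP[] := truncn_itv (mulr_ge0 t0 (ler0n _ n.+1)).
  + exact: cvg_cst.
  + rewrite -[X in _ --> X]addr0; apply: cvgD; first exact: cvg_cst.
    exact: cvg_harmonic.
Unshelve. all: by end_near. Qed.

Section flow.
Variables (R : realType) (g : R -> R) (Phi : R -> R -> R).
Hypotheses (g_lip : locally_lipschitz g) (Phi_flow : semiflow_of g Phi).

Lemma flow_homo t : 0 <= t -> {homo Phi ^~ t : x y / x <= y}.
Proof.
move=> t0 x y xy; have [x0 hx] := Phi_flow x; have [y0 hy] := Phi_flow y.
by apply: (ode_solution_le g_lip hx hy) => //; rewrite x0 y0.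
Qed.

(** Both sides solve the equation in [t] with the same value at [t = 0], and the
    solution with given initial value is unique by comparison both ways. *)
Lemma flowD x s t : 0 <= s -> 0 <= t -> Phi x (s + t) = Phi (Phi x s) t.
Proof.
move=> s0 t0; have [_ hx] := Phi_flow x.
have hs := ode_solution_shift s0 hx.
have [h0 hy] := Phi_flow (Phi x s).
have st0 : Phi x (s + 0) = Phi (Phi x s) 0 by rewrite addr0 h0.
apply/le_anti/andP; split.
- by apply: (ode_solution_le g_lip hs hy) => //; rewrite st0.
- by apply: (ode_solution_le g_lip hy hs) => //; rewrite st0.
Qed.

Lemma measurable_flow :
  measurable_fun setT (fun p : R * R => Phi p.1 (Num.max p.2 0)).
Proof.
apply: measurable_fun_right_continuous => [t t0|x t t0].
  by apply: nondecreasing_measurable => //; exact: flow_homo.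
by have [_ hx] := Phi_flow x; exact: ode_solution_right_continuous hx _ t0.
Qed.

End flow.

(** * Preliminaries on measures and integrals *)

Lemma expr_lt_eventually (R : realType) (M q e : R) : `|q| < 1 -> 0 < e ->
  exists n, M * q ^+ n < e.
Proof.
move=> q1 e0; have cq : M * q ^+ n @[n --> \oo] --> M * 0.
  by apply: cvgM; [exact: cvg_cst|exact: cvg_expr].
have [n _ /(_ n (leqnn n)) /= Mq] : \forall n \near \oo, M * q ^+ n < e.
  by apply: (cvgr_lt _ cq); rewrite mulr0.
by exists n.
Qed.

Section rays.
Variable R : realType.
Local Open Scope ereal_scope.

Lemma eq_measure_rays (m1 m2 : {measure set R -> \bar R}) :
  (forall a : R, m1 `]a, +oo[%classic = m2 `]a, +oo[%classic) ->
  m1 setT < +oo -> forall B, measurable B -> m1 B = m2 B.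
Proof.
move=> m12 m1oo; apply: (measure_unique (@RGenOInfty.G R)
  (fun n => `](- n%:R)%R, +oo[%classic)).
- exact: RGenOInfty.measurableE.
- move=> _ _ [a ->] [b ->]; exists (Num.max a b); apply/seteqP.
  split => x /=; rewrite !in_itv/= !andbT gt_max.
    by move=> [-> ->].
  by move=> /andP[].
- by move=> i; exists (- i%:R)%R.
- apply/seteqP; split => // x _.
  exists (Num.bound `|x|) => //=; rewrite in_itv/= andbT ltrNl.
  by rewrite (le_lt_trans (ler_norm (- x)))// normrN archi_boundP.
- by move=> _ [a ->].
- move=> k; apply: le_lt_trans m1oo; apply: le_measure => //; exact: mem_set.
Qed.

End rays.

Lemma integral_probability_cst d (T : measurableType d) (R : realType)
    (P : probability T R) (c : R) : (\int[P]_x c%:E = c%:E)%E.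
Proof.
by rewrite integral_cst// -[RHS]mule1; congr (_ * _)%E; exact: probability_setT.
Qed.

Section partial_integral.
Context d (T : measurableType d) (R : realType).
Local Open Scope ereal_scope.
Implicit Types (F : T * R -> \bar R) (m : probability R R).

(** The integrands for which Tonelli's theorem needs no finiteness condition. *)
Definition nneg_mfun d' (U : measurableType d') (F : U -> \bar R) : Prop :=
  measurable_fun setT F /\ forall x, 0 <= F x.

Definition pintegral m F (t : T) := \int[m]_e F (t, e).

Lemma nneg_mfun_pair F t : nneg_mfun F -> nneg_mfun (fun e => F (t, e)).
Proof.
move=> [mF F0]; split => //.
by apply: measurableT_comp => //; exact: measurable_pair1.
Qed.

Lemma nneg_mfun_pintegral m F : nneg_mfun F -> nneg_mfun (pintegral m F).
Proof.
move=> [mF F0]; split; first exact: measurable_fun_fubini_tonelli_F.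
by move=> t; exact: integral_ge0.
Qed.

Lemma le_pintegral m F1 F2 : nneg_mfun F1 -> nneg_mfun F2 ->
  (forall x, F1 x <= F2 x) -> forall t, pintegral m F1 t <= pintegral m F2 t.
Proof.
move=> F1m F2m F12 t.
have [m1 p1] := nneg_mfun_pair t F1m; have [m2 p2] := nneg_mfun_pair t F2m.
by apply: ge0_le_integral => // x _; exact: F12.
Qed.

Lemma pintegralD m F1 F2 : nneg_mfun F1 -> nneg_mfun F2 ->
  pintegral m (fun x => F1 x + F2 x) = (fun t => pintegral m F1 t + pintegral m F2 t).
Proof.
move=> F1m F2m; apply/funext => t.
have [m1 p1] := nneg_mfun_pair t F1m; have [m2 p2] := nneg_mfun_pair t F2m.
exact: ge0_integralD.
Qed.

Lemma pintegral_nneseries m (F : nat -> T * R -> \bar R) :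
  (forall n, nneg_mfun (F n)) ->
  pintegral m (fun x => \sum_(n <oo) F n x) =
  (fun t => \sum_(n <oo) pintegral m (F n) t).
Proof.
move=> Fm; apply/funext => t; apply: integral_nneseries => //.
- by move=> n; have [] := nneg_mfun_pair t (Fm n).
- by move=> n e _; have [_ ] := Fm n.
Qed.

End partial_integral.

Lemma nneg_mfun_comp d d' (U : measurableType d) (V : measurableType d')
    (R : realType) (F : V -> \bar R) (u : U -> V) :
  nneg_mfun F -> measurable_fun setT u -> nneg_mfun (fun x => F (u x)).
Proof. by move=> [mF F0] mu; split => //; exact: measurableT_comp. Qed.

Lemma nneg_mfunD d (U : measurableType d) (R : realType) (F1 F2 : U -> \bar R) :
  nneg_mfun F1 -> nneg_mfun F2 -> nneg_mfun (fun x => (F1 x + F2 x)%E).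
Proof.
move=> [m1 p1] [m2 p2]; split; first exact: emeasurable_funD.
by move=> x; rewrite adde_ge0.
Qed.

Lemma nneg_integralD d (U : measurableType d) (R : realType)
    (m : {measure set U -> \bar R}) (F1 F2 : U -> \bar R) :
  nneg_mfun F1 -> nneg_mfun F2 ->
  (\int[m]_x (F1 x + F2 x) = \int[m]_x F1 x + \int[m]_x F2 x)%E.
Proof. by move=> [m1 p1] [m2 p2]; exact: ge0_integralD. Qed.

Lemma le_nneg_integral d (U : measurableType d) (R : realType)
    (m : {measure set U -> \bar R}) (F1 F2 : U -> \bar R) :
  nneg_mfun F1 -> nneg_mfun F2 -> (forall x, F1 x <= F2 x)%E ->
  (\int[m]_x F1 x <= \int[m]_x F2 x)%E.
Proof. by move=> [m1 p1] [m2 p2] F12; exact: ge0_le_integral. Qed.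

Lemma nneg_mfun_nneseries d (U : measurableType d) (R : realType)
    (F : nat -> U -> \bar R) : (forall n, nneg_mfun (F n)) ->
  nneg_mfun (fun x => (\sum_(n <oo) F n x)%E).
Proof.
move=> Fm; split.
  by apply: ge0_emeasurable_sum => [n x _ _|n _]; have [] := Fm n.
by move=> x; apply: nneseries_ge0 => n _ _; have [] := Fm n.
Qed.

(** * The transition operators as a sum over the number of jumps *)

(** What the analysis of the transition operators uses of the flow, of [h] and of
    the law [eta] of the waiting times. The time of the flow is truncated at 0, as
    nothing is known of the flow at negative times. *)
Record jump_model (R : realType) (Phi : R -> R -> R) (h : R -> R) (lambda : R)
    (eta : probability R R) : Prop := JumpModel {
  measurable_Phi :
    measurable_fun setT (fun p : R * R => Phi p.1 (Num.max p.2 0));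
  PhiD : forall x s t, 0 <= s -> 0 <= t -> Phi x (s + t) = Phi (Phi x s) t;
  Phi_homo : forall t, 0 <= t -> {homo Phi ^~ t : x y / x <= y};
  h_homo : {homo h : x y / x <= y};
  eta_tail : forall t, 0 <= t ->
    eta `]t, +oo[%classic = (expR (- lambda * t))%:E }.

Section jump_semigroup.
Variables (R : realType) (Phi : R -> R -> R) (h : R -> R) (lambda : R).
Variables (eta nu : probability R R).
Hypothesis model : jump_model Phi h lambda eta.

Local Open Scope ereal_scope.
Implicit Types (f : R -> \bar R) (F V : R * R -> \bar R) (y : R * R).

(** One jump of the chain of pairs [y] = (state, time left): flow for the waiting
    time [e], then jump with shock [z]. With the time left as second component the
    chain is homogeneous in time. The truncation of [e] changes nothing for
    nonnegative waiting times, and makes the step total. *)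
Definition jump_step y (e z : R) : R * R :=
  (h (Phi y.1 (Num.max e 0%R)) + z, y.2 - Num.max e 0)%R.

Definition jump_op F : R * R -> \bar R :=
  pintegral eta (pintegral nu
    (fun p : R * R * R * R => F (jump_step p.1.1 p.1.2 p.2))).

(** The expectation of [f] at the end of the time left, on the event that no jump
    occurs until then. *)
Definition no_jump f y : \bar R :=
  if (0 <= y.2)%R
  then (expR (- lambda * y.2))%:E * f (Phi y.1 (Num.max y.2 0%R)) else 0.

(** The [n]-th term is the expectation of [f (X_t)] on the event of [n] jumps before
    [t], for the process started at [y.1] and with [t = y.2]; so the sum is
    [P_t f]. *)
Definition income_op f y : \bar R :=
  \sum_(n <oo) iter n jump_op (no_jump f) y.

Lemma no_jumpE f x r : (0 <= r)%R ->
  no_jump f (x, r) = (expR (- lambda * r))%:E * f (Phi x r).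
Proof. by move=> r0; rewrite /no_jump/= r0 max_l. Qed.

Lemma measurable_max0 : measurable_fun setT (fun t : R => Num.max t 0%R).
Proof. exact: measurable_maxr. Qed.

Lemma measurable_jump_step :
  measurable_fun setT (fun p : R * R * R * R => jump_step p.1.1 p.1.2 p.2).
Proof.
have mh : measurable_fun setT h.
  exact: nondecreasing_measurable measurableT (h_homo model).
have m11 : measurable_fun setT (fun p : R * R * R * R => p.1.1).
  exact: measurableT_comp.
have m12 : measurable_fun setT (fun p : R * R * R * R => p.1.2).
  exact: measurableT_comp.
have m111 : measurable_fun setT (fun p : R * R * R * R => p.1.1.1).
  exact: measurableT_comp m11.
have m112 : measurable_fun setT (fun p : R * R * R * R => p.1.1.2).
  exact: measurableT_comp m11.
apply: measurable_fun_pair.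
- apply: measurable_funD; last exact: measurable_snd.
  apply: (measurableT_comp mh).
  exact: (measurableT_comp (measurable_Phi model) (measurable_fun_pair m111 m12)).
- apply: measurable_funB => //.
  exact: (measurableT_comp measurable_max0 m12).
Qed.

Lemma nneg_mfun_jump F : nneg_mfun F ->
  nneg_mfun (fun p : R * R * R * R => F (jump_step p.1.1 p.1.2 p.2)).
Proof. by move=> Fm; apply: nneg_mfun_comp Fm _; exact: measurable_jump_step. Qed.

Lemma nneg_mfun_jump_op F : nneg_mfun F -> nneg_mfun (jump_op F).
Proof. by move=> Fm; do 2 apply: nneg_mfun_pintegral; exact: nneg_mfun_jump. Qed.

Lemma nneg_mfun_iter F n : nneg_mfun F -> nneg_mfun (iter n jump_op F).
Proof. by move=> Fm; elim: n => //= n; exact: nneg_mfun_jump_op. Qed.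

Lemma le_jump_op F1 F2 : nneg_mfun F1 -> nneg_mfun F2 ->
  (forall y, F1 y <= F2 y) -> forall y, jump_op F1 y <= jump_op F2 y.
Proof.
move=> m1 m2 F12; apply: le_pintegral.
- exact/nneg_mfun_pintegral/nneg_mfun_jump.
- exact/nneg_mfun_pintegral/nneg_mfun_jump.
- by apply: le_pintegral => //; exact: nneg_mfun_jump.
Qed.

Lemma le_iter F1 F2 n : nneg_mfun F1 -> nneg_mfun F2 ->
  (forall y, F1 y <= F2 y) ->
  forall y, iter n jump_op F1 y <= iter n jump_op F2 y.
Proof.
move=> m1 m2 F12; elim: n => [|n IHn] //=.
by apply: le_jump_op => //; exact: nneg_mfun_iter.
Qed.

Lemma jump_opD F1 F2 : nneg_mfun F1 -> nneg_mfun F2 ->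
  jump_op (fun y => F1 y + F2 y) = (fun y => jump_op F1 y + jump_op F2 y).
Proof.
move=> m1 m2; rewrite /jump_op -pintegralD.
- by congr pintegral; rewrite -pintegralD//; exact: nneg_mfun_jump.
- exact/nneg_mfun_pintegral/nneg_mfun_jump.
- exact/nneg_mfun_pintegral/nneg_mfun_jump.
Qed.

Lemma iterD F1 F2 n : nneg_mfun F1 -> nneg_mfun F2 ->
  iter n jump_op (fun y => F1 y + F2 y) =
  (fun y => iter n jump_op F1 y + iter n jump_op F2 y).
Proof.
move=> m1 m2; elim: n => //= n ->.
by rewrite jump_opD//; exact: nneg_mfun_iter.
Qed.

Lemma jump_op_nneseries (F : nat -> R * R -> \bar R) :
  (forall n, nneg_mfun (F n)) ->
  jump_op (fun y => \sum_(n <oo) F n y) = (fun y => \sum_(n <oo) jump_op (F n) y).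
Proof.
move=> Fm; rewrite /jump_op -pintegral_nneseries => [|n].
  by congr pintegral; rewrite -pintegral_nneseries// => n; exact: nneg_mfun_jump.
exact/nneg_mfun_pintegral/nneg_mfun_jump.
Qed.

Lemma nneg_mfun_no_jump f : nneg_mfun f -> nneg_mfun (no_jump f).
Proof.
move=> [mf f0]; split; last first.
  by move=> y; rewrite /no_jump; case: ifP => // _; rewrite mule_ge0.
apply: measurable_fun_ifT => //; first exact: measurable_fun_ler.
apply: emeasurable_funM; last exact: measurableT_comp (measurable_Phi model).
apply/measurable_EFinP/measurableT_comp => //.
exact: measurable_funM.
Qed.

Lemma nneg_mfun_income_op f : nneg_mfun f -> nneg_mfun (income_op f).
Proof.
by move=> fm; apply: nneg_mfun_nneseries => n; exact/nneg_mfun_iter/nneg_mfun_no_jump.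
Qed.

(** The renewal equation: the first term is the case without a jump, the second
    conditions on the first jump. *)
Lemma income_opE f : nneg_mfun f ->
  income_op f = (fun y => no_jump f y + jump_op (income_op f) y).
Proof.
move=> /nneg_mfun_no_jump fm; rewrite [in RHS]/income_op jump_op_nneseries; last first.
  by move=> n; exact: nneg_mfun_iter.
apply/funext => y; rewrite /income_op nneseries_recl//.
  rewrite -(nneseries_addn 1) => [|n].
    by congr (_ + _); apply: eq_eseriesr => n _; rewrite addn1.
  by have [_] := nneg_mfun_iter n fm; exact.
by move=> n _; have [_] := nneg_mfun_iter n fm; exact.
Qed.

Lemma le_income_op f1 f2 : nneg_mfun f1 -> nneg_mfun f2 ->
  (forall x, f1 x <= f2 x) -> forall y, income_op f1 y <= income_op f2 y.
Proof.
move=> m1 m2 f12 y; apply: lee_nneseries => [n _ _|n _].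
  by have [_] := nneg_mfun_iter n (nneg_mfun_no_jump m1); exact.
apply: le_iter; try exact: nneg_mfun_no_jump.
by move=> z; rewrite /no_jump; case: ifP => // _; rewrite lee_pmul// (proj2 m1).
Qed.

Lemma jump_op_lt0 F : (forall y, (y.2 < 0)%R -> F y = 0) ->
  forall y, (y.2 < 0)%R -> jump_op F y = 0.
Proof.
move=> F0 y y0; apply: integral0_eq => e _; apply: integral0_eq => z _.
by apply: F0 => /=; rewrite (le_lt_trans _ y0)// gerBl le_max lexx orbT.
Qed.

Lemma iter_lt0 F n : (forall y, (y.2 < 0)%R -> F y = 0) ->
  forall y, (y.2 < 0)%R -> iter n jump_op F y = 0.
Proof. by move=> F0; elim: n => //= n; exact: jump_op_lt0. Qed.

Lemma income_op_lt0 f y : (y.2 < 0)%R -> income_op f y = 0.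
Proof.
move=> y0; rewrite /income_op eseries0// => n _ _; apply: iter_lt0 => // z z0.
by rewrite /no_jump leNgt z0.
Qed.

Lemma eta_le t : (0 <= t)%R ->
  eta `]-oo, t]%classic = (1 - expR (- lambda * t))%:E.
Proof.
move=> t0; rewrite -[`]-oo, t]%classic]setCK setCitvl.
by rewrite probability_setC// (eta_tail model).
Qed.

Lemma jump_prob_lt1 t : (0 <= t)%R -> (`|1 - expR (- lambda * t)| < 1)%R.
Proof.
move=> t0; rewrite ger0_norm; first by rewrite ltrBlDr ltrDl expR_gt0.
by rewrite -lee_fin -eta_le.
Qed.

Lemma integral_eta_itv (c t : R) : (0 <= c)%R -> (0 <= t)%R ->
  \int[eta]_e (c%:E * (\1_`]-oo, t] e)%:E) =
  (c * (1 - expR (- lambda * t)))%:E.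
Proof.
move=> c0 t0; rewrite ge0_integralZl_EFin//; last first.
  exact/measurable_EFinP/measurable_indic.
by rewrite integral_indic// setIT EFinM; congr (_ * _); exact: eta_le.
Qed.

(** [jump_op] preserves vanishing at negative time left, so each further jump
    before the time [s] costs a factor [P (E <= s) = 1 - expR (- lambda * s)]. *)
Lemma iter_jump_op_le V (M s : R) : nneg_mfun V -> (forall y, V y <= M%:E) ->
  (forall y, (y.2 < 0)%R -> V y = 0) -> (0 <= M)%R -> (0 <= s)%R ->
  forall n y, (y.2 <= s)%R ->
    iter n jump_op V y <= (M * (1 - expR (- lambda * s)) ^+ n)%:E.
Proof.
move=> Vm VM V0 M0 s0; elim=> [|n IHn] y ys; first by rewrite expr0 mulr1.
rewrite /= exprSr mulrA; set c := (M * _)%R.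
have c0 : (0 <= c)%R.
  by rewrite mulr_ge0// exprn_ge0// -lee_fin -eta_le.
have Wm := nneg_mfun_iter n Vm; have W0 := @iter_lt0 _ n V0.
set W := iter n jump_op V in IHn Wm W0 *.
apply: (@le_trans _ _ (\int[eta]_e (c%:E * (\1_`]-oo, s] e)%:E))); last by rewrite integral_eta_itv.
have [mW pW] := nneg_mfun_pair y (nneg_mfun_pintegral nu (nneg_mfun_jump Wm)).
apply: ge0_le_integral => //.
  by apply/measurable_EFinP/measurable_funM => //; exact: measurable_indic.
move=> e _; have := nneg_mfun_pair (y, e) (nneg_mfun_jump Wm) => -[mz pz].
have [es|es] := leP e s.
  rewrite indicE mem_set /= ?in_itv//= mule1.
  apply: (@le_trans _ _ (\int[nu]_z c%:E)); last first.
    by rewrite integral_probability_cst.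
  apply: ge0_le_integral => // z _; apply: IHn => /=.
  by rewrite (le_trans _ ys)// gerBl le_max lexx orbT.
rewrite indicE memNset/=; last by rewrite in_itv/= leNgt es.
rewrite mule0.
rewrite le_eqVlt; apply/orP; left; apply/eqP; apply: integral0_eq => z _.
by apply: W0 => /=; rewrite subr_lt0 (le_lt_trans ys)// lt_max es.
Qed.

(** Bounded solutions of the renewal equation agree: their iterates under
    [jump_op] vanish in the limit, since the number of jumps before a fixed
    time has a geometrically decaying tail. *)
Lemma income_op_unique f V (M : R) : nneg_mfun f -> nneg_mfun V ->
  (0 <= M)%R -> (forall y, V y <= M%:E) -> (forall y, (y.2 < 0)%R -> V y = 0) ->
  V = (fun y => no_jump f y + jump_op V y) -> V = income_op f.
Proof.
move=> fm Vm M0 VM V0 VE; have Gm := nneg_mfun_no_jump fm.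
have Vn n y : V y = \sum_(0 <= k < n) iter k jump_op (no_jump f) y +
                    iter n jump_op V y.
  elim: n => [|n IHn]; first by rewrite big_geq// add0e.
  rewrite IHn big_nat_recr//= -addeA; congr (_ + _).
  rewrite {1}VE iterD//; last exact: nneg_mfun_jump_op.
  by rewrite -iterSr.
have it0 n y : 0 <= iter n jump_op (no_jump f) y.
  by have [_] := nneg_mfun_iter n Gm; exact.
apply/funext => y; apply/eqP; rewrite eq_le; apply/andP; split; last first.
  apply: lime_le; first exact: is_cvg_nneseries.
  near=> n; rewrite (Vn n y) leeDl//.
  by have [_] := nneg_mfun_iter n Vm; exact.
apply/lee_addgt0Pr => e e0.
pose s := Num.max y.2 0%R; pose q := (1 - expR (- lambda * s))%R.
have s0 : (0 <= s)%R by rewrite le_max lexx orbT.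
have [n Mq] := expr_lt_eventually M (jump_prob_lt1 s0) e0.
rewrite (Vn n y) leeD//; first exact: nneseries_lim_ge.
apply: (@le_trans _ _ (M * q ^+ n)%:E); last by rewrite lee_fin ltW.
by apply: iter_jump_op_le => //; rewrite le_max lexx.
Unshelve. all: by end_near. Qed.

(** The process does not explode: all the mass is at finite numbers of jumps,
    because the constant solves the renewal equation as well. *)
Lemma income_op_cst (c : R) : (0 <= c)%R ->
  income_op (cst c%:E) = (fun y => if (0 <= y.2)%R then c%:E else 0).
Proof.
move=> c0; apply/esym/(@income_op_unique _ _ c) => //.
- split; last by move=> y; case: ifP; rewrite ?lee_fin.
  by apply: measurable_fun_ifT => //; exact: measurable_fun_ler.
- by move=> y; case: ifP => //; rewrite lee_fin.
- by move=> y; rewrite ltNge => /negbTE ->.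
apply/funext => -[x r] /=; rewrite /no_jump/=; case: ifPn => [r0|]; last first.
  rewrite -ltNge => r0; rewrite add0e jump_op_lt0// => y.
  by rewrite ltNge => /negbTE ->.
transitivity ((expR (- lambda * r))%:E * c%:E +
    \int[eta]_e (c%:E * (\1_`]-oo, r] e)%:E)).
  by rewrite integral_eta_itv// -EFinM -EFinD; congr EFin; ring.
congr (_ + _); apply: eq_integral => e _; rewrite /pintegral /=.
rewrite subr_ge0 ge_max r0 andbT indicE.
have [er|er] := leP e r.
  by rewrite integral_probability_cst mem_set /= ?in_itv//= mule1.
by rewrite integral0 memNset/= ?mule0// in_itv/= leNgt er.
Qed.

Lemma income_op_le f (c : R) : nneg_mfun f -> (0 <= c)%R ->
  (forall x, f x <= c%:E) -> forall y, income_op f y <= c%:E.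
Proof.
move=> fm c0 fc y; apply: (@le_trans _ _ (income_op (cst c%:E) y)).
  by apply: le_income_op.
by rewrite income_op_cst//; case: ifP; rewrite ?lee_fin.
Qed.

Lemma income_op_ge f (c : R) : nneg_mfun f -> (0 <= c)%R ->
  (forall x, c%:E <= f x) -> forall y, (0 <= y.2)%R -> c%:E <= income_op f y.
Proof.
move=> fm c0 cf y y0; apply: (@le_trans _ _ (income_op (cst c%:E) y)).
  by rewrite income_op_cst// y0.
by apply: le_income_op.
Qed.

Lemma income_op_homo f t : nneg_mfun f -> {homo f : x y / (x <= y)%R >-> x <= y} ->
  {homo (fun x => income_op f (x, t)) : x y / (x <= y)%R >-> x <= y}.
Proof.
move=> fm f_homo x1 x2 x12; have Gm := nneg_mfun_no_jump fm.
apply: lee_nneseries => [n _ _|n _].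
  by have [_] := nneg_mfun_iter n Gm; exact.
elim: n t x1 x2 x12 => [|n IHn] t x1 x2 x12 /=.
  rewrite /no_jump/=; case: ifP => // _; rewrite lee_wpmul2l//.
  by apply/f_homo/(Phi_homo model) => //; rewrite le_max lexx orbT.
have Wm := nneg_mfun_jump (nneg_mfun_iter n Gm).
have [m1 p1] := nneg_mfun_pair (x1, t) (nneg_mfun_pintegral nu Wm).
have [m2 p2] := nneg_mfun_pair (x2, t) (nneg_mfun_pintegral nu Wm).
apply: ge0_le_integral => // e _.
have [m1' p1'] := nneg_mfun_pair (x1, t, e) Wm.
have [m2' p2'] := nneg_mfun_pair (x2, t, e) Wm.
apply: ge0_le_integral => // z _; apply: IHn => /=.
by rewrite lerD2r; apply/(h_homo model)/(Phi_homo model) => //; rewrite le_max lexx orbT.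
Qed.

(** Memorylessness: beyond [s], the waiting-time law is its own translate by [s],
    scaled by the probability of exceeding [s]. *)
Lemma integral_eta_tail (k : R -> \bar R) s : (0 <= s)%R -> nneg_mfun k ->
  \int[eta]_(e in `]s, +oo[) k e =
  (expR (- lambda * s))%:E * \int[eta]_e k (s + Num.max e 0)%R.
Proof.
move=> s0 [mk k0].
have mi : measurable (`]s, +oo[%classic : set R) by [].
have ms : measurable_fun setT (fun e : R => (s + Num.max e 0)%R).
  exact: measurable_funD measurable_max0.
pose X : {mfun R >-> R} := HB.pack (fun e : R => (s + Num.max e 0)%R)
  (isMeasurableFun.Build _ _ _ _ (fun e : R => (s + Num.max e 0)%R) ms).
pose c := NngNum (expR_ge0 (- lambda * s)).
pose m1 : {measure set R -> \bar R} := mrestr eta mi.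
pose m2 : {measure set R -> \bar R} := mscale c (distribution eta X).
have m12 B : measurable B -> m1 B = m2 B.
  apply: eq_measure_rays => [a|]; last first.
    by rewrite /m1 /= /mrestr setTI (le_lt_trans (probability_le1 _ _))// ltry.
  rewrite /m1 /m2 /= /mscale/= /mrestr /distribution/= /pushforward.
  have [sa|sa] := leP s a.
    rewrite (_ : _ `&` _ = `]a, +oo[%classic); last first.
      apply/seteqP; split => e /=; rewrite !in_itv/= !andbT; first by case.
      by move=> ae; split => //; exact: le_lt_trans ae.
    rewrite (_ : _ @^-1` _ = `](a - s)%R, +oo[%classic); last first.
      apply/seteqP; split => e /=; rewrite !in_itv/= !andbT -ltrBlDl lt_max.
        by case/orP => //; rewrite subr_lt0 ltNge sa.
      by move=> ->.
    rewrite !(eta_tail model) ?subr_ge0//; last exact: le_trans sa.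
    by rewrite -EFinM -expRD; congr (expR _)%:E; ring.
  rewrite (_ : _ `&` _ = `]s, +oo[%classic); last first.
    apply/seteqP; split => e /=; rewrite !in_itv/= !andbT; first by case.
    by move=> ae; split => //; exact: lt_trans ae.
  rewrite (_ : _ @^-1` _ = setT); last first.
    apply/seteqP; split => e //= _; rewrite !in_itv/= !andbT.
    by rewrite (lt_le_trans sa)// lerDl le_max lexx orbT.
  by rewrite (eta_tail model)// probability_setT mule1.
have -> : \int[eta]_(e in `]s, +oo[) k e = \int[m2]_(e in `]s, +oo[) k e.
  apply: eq_measure_integral => A mA As; rewrite -m12// /m1 /= /mrestr.
  by rewrite setIidl.
have mk' : measurable_fun `]s, +oo[%classic k by exact: measurable_funTS.
rewrite ge0_integral_mscale//; congr (_ * _).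
rewrite ge0_integral_pushforward//.
rewrite (_ : _ @^-1` _ = setT `\` `]-oo, 0%R]%classic); last first.
  apply/seteqP; split => e /=; rewrite !in_itv/= ?andbT ltrDl lt_max ltxx orbF.
    by move=> e0; split => //; apply/negP; rewrite -ltNge.
  by move=> [_ /negP]; rewrite -ltNge.
rewrite -ge0_negligible_integral//.
- exact: measurableT_comp.
- by move=> e _; exact: k0.
- by rewrite [LHS]eta_le// mulr0 expR0 subrr.
Qed.

(** In the renewal equation for [P_(r + t) f], split the integral over the first
    waiting time at [r]. By memorylessness and the flow property, the part beyond
    [r], with the term without a jump, is the term without a jump in the renewal
    equation for [P_r (P_t f)]. So both sides are bounded solutions of the latter,
    extended by 0 to negative times. *)
Lemma income_op_semigroup f (M : R) x s t : nneg_mfun f -> (0 <= M)%R ->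
  (forall z, f z <= M%:E) -> (0 <= s)%R -> (0 <= t)%R ->
  income_op f (x, (s + t)%R) = income_op (fun z => income_op f (z, t)) (x, s).
Proof.
move=> fm M0 fM s0 t0; have Um := nneg_mfun_income_op fm.
set U := income_op f in Um *.
have f'm : nneg_mfun (fun z => U (z, t)).
  by apply: (nneg_mfun_comp Um); exact: measurable_pair2.
pose V y := if (0 <= y.2)%R then U (y.1, (y.2 + t)%R) else 0.
suff <- : V = income_op (fun z => U (z, t)) by rewrite /V /= s0.
have V0 y : (y.2 < 0)%R -> V y = 0 by rewrite /V ltNge => /negbTE ->.
have Vm : nneg_mfun V.
  split; last by move=> y; rewrite /V; case: ifP => // _; exact: (proj2 Um).
  apply: measurable_fun_ifT => //; first exact: measurable_fun_ler.
  apply: (measurableT_comp (proj1 Um)); apply: measurable_fun_pair => //.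
  exact: measurable_funD.
apply: (@income_op_unique _ _ M) => //.
  by move=> y; rewrite /V; case: ifP => // _; exact: income_op_le.
apply/funext => -[z r]; have [r0|r0] := leP 0%R r; last first.
  by rewrite V0//= jump_op_lt0// adde0 /no_jump/= leNgt r0.
rewrite {1}/V /= r0.
have Ue y : U y = no_jump f y + jump_op U y by rewrite /U {1}income_opE.
have jumpE : jump_op U (z, (r + t)%R) =
    jump_op V (z, r) + (expR (- lambda * r))%:E * jump_op U (Phi z r, t).
  pose k e := pintegral nu
    (fun p : R * R * R * R => U (jump_step p.1.1 p.1.2 p.2)) ((z, (r + t)%R), e).
  have km : nneg_mfun k.
    exact: (nneg_mfun_pair (z, (r + t)%R) (nneg_mfun_pintegral nu (nneg_mfun_jump Um))).
  have [mk k0] := km.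
  rewrite [LHS](_ : _ = \int[eta]_(e in `]-oo, r] `|` `]r, +oo[) k e); last first.
    rewrite (_ : _ `|` _ = setT)//; apply/seteqP; split => // e _ /=.
    by rewrite !in_itv/= andbT; case: leP => _; [left|right].
  rewrite ge0_integral_setU//; last 2 first.
  - exact: measurable_funTS.
  - apply/disj_setPS => e /=; rewrite !in_itv/= andbT => -[er].
    by rewrite ltNge er.
  congr (_ + _).
    rewrite integral_mkcond; apply: eq_integral => e _; rewrite patchE.
    case: ifPn => [|]; rewrite ?notin_setE ?inE/= in_itv/= => er.
      apply: eq_integral => u _; rewrite /V /= subr_ge0 ge_max er r0/=.
      by congr (U (_, _)) => /=; ring.
    apply/esym/integral0_eq => u _; apply: V0 => /=.
    by rewrite subr_lt0 lt_max ltNge; move/negP : er => ->.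
  have -> : jump_op U (Phi z r, t) = \int[eta]_e k (r + Num.max e 0)%R.
    apply: eq_integral => e _; apply: eq_integral => u _.
    have e0 : (0 <= Num.max e 0)%R by rewrite le_max lexx orbT.
    rewrite /jump_step/= (max_l (addr_ge0 r0 e0)) (PhiD model)//.
    by congr (U (_, _)) => /=; ring.
  exact: (integral_eta_tail r0 km).
rewrite Ue jumpE addeCA [RHS]addeC; congr (_ + _).
have G0 := proj2 (nneg_mfun_no_jump fm).
have J0 := proj2 (nneg_mfun_jump_op Um).
rewrite !no_jumpE ?addr_ge0// Ue (@ge0_muleDr _ _ _ _ (G0 _) (J0 _)) no_jumpE// (PhiD model)//.
by rewrite muleA -EFinM -expRD mulrDr.
Qed.

End jump_semigroup.

(** * Contraction of the oscillation *)

Section shock_contraction.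
Local Open Scope ereal_scope.
Variables (R : realType) (nu : probability R R).
Variables (hm hM alpha beta z0 delta : R).
Hypotheses (alpha_z0 : (hM + alpha <= z0)%R) (z0_beta : (z0 <= hm + beta)%R)
  (alpha_beta : (alpha <= beta)%R).
Hypotheses (nu_low : delta%:E <= nu `]-oo, alpha[%classic)
  (nu_high : delta%:E <= nu `]beta, +oo[%classic).

Lemma delta_le1 : (delta <= 1)%R.
Proof. by rewrite -lee_fin (le_trans nu_low)// probability_le1. Qed.

(** Write [w := u z0]. With probability at least [delta] the shock is below [alpha];
    then [u (hM + z) <= w], an improvement by [l + c - w] on the trivial bound
    [l + c]. With probability at least [delta] it is above [beta]; then
    [w <= u (hm + z)], an improvement by [w - l]. The improvements add up to [c],
    and the events are disjoint as [alpha <= beta]. *)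
Lemma shock_contraction (u : R -> R) (l c : R) :
  {homo u : x y / (x <= y)%R} -> (0 <= l)%R ->
  (forall x, (l <= u x <= l + c)%R) ->
  \int[nu]_z (u (hM + z)%R)%:E <=
  \int[nu]_z (u (hm + z)%R)%:E + ((1 - delta) * c)%:E.
Proof.
move=> u_homo l0 lu; pose w := u z0.
have u0 x : (0 <= u x)%R by case/andP: (lu x) => /(le_trans l0).
have /andP[lw wc] := lu z0.
have mu x : measurable_fun setT (fun z : R => (u (x + z)%R)%:E).
  apply/measurable_EFinP; apply: nondecreasing_measurable => // z1 z2 z12.
  by apply: u_homo; rewrite lerD2l.
have c0 : (0 <= c)%R.
  by case/andP: (lu z0) => ? ?; rewrite -(lerD2l l) addr0; exact: le_trans wc.
pose A : set R := `]-oo, alpha[%classic; pose B : set R := `]beta, +oo[%classic.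
have mesA : measurable A by exact: measurable_itv.
have mesB : measurable B by exact: measurable_itv.
pose sA (z : R) := (l + c - w)%:E * (\1_A z)%:E.
pose sB (z : R) := (w - l)%:E * (\1_B z)%:E.
have lcw : (0 <= l + c - w)%R by rewrite subr_ge0.
have wl : (0 <= w - l)%R by rewrite subr_ge0.
have mA : nneg_mfun sA.
  split=> [|z]; last by rewrite mule_ge0 ?lee_fin.
  apply: emeasurable_funM => //.
  exact/measurable_EFinP/measurable_indic.
have mB : nneg_mfun sB.
  split=> [|z]; last by rewrite mule_ge0 ?lee_fin.
  apply: emeasurable_funM => //.
  exact/measurable_EFinP/measurable_indic.
have uM : nneg_mfun (fun z : R => (u (hM + z)%R)%:E).
  by split => // z; rewrite lee_fin.
have um : nneg_mfun (fun z : R => (u (hm + z)%R)%:E).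
  by split => // z; rewrite lee_fin.
have iA : (delta * (l + c - w))%:E <= \int[nu]_z sA z.
  rewrite ge0_integralZl_EFin//; last exact/measurable_EFinP/measurable_indic.
  rewrite integral_indic// setIT mulrC EFinM; apply: lee_wpmul2l => //; exact: nu_low.
have iB : (delta * (w - l))%:E <= \int[nu]_z sB z.
  rewrite ge0_integralZl_EFin//; last exact/measurable_EFinP/measurable_indic.
  rewrite integral_indic// setIT mulrC EFinM; apply: lee_wpmul2l => //; exact: nu_high.
have pw z : (u (hM + z)%R)%:E + (sA z + sB z) <= (u (hm + z)%R)%:E + c%:E.
  have /andP[lM Mc] := lu (hM + z)%R; have /andP[lm mc] := lu (hm + z)%R.
  rewrite /sA /sB -!EFinM -!EFinD lee_fin !indicE.
  have [zA|zA] := ltP z alpha.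
    have -> : z \in A by rewrite inE /A/= in_itv.
    have -> : (z \in B) = false.
      by apply/negbTE; rewrite notin_setE /B/= in_itv/= andbT; apply/negP;
        rewrite -leNgt (le_trans (ltW zA)).
    have : (u (hM + z) <= w)%R.
      by apply: u_homo; rewrite (le_trans _ alpha_z0)// lerD2l ltW.
    by rewrite /=; lra.
  have -> : (z \in A) = false.
    by apply/negbTE; rewrite notin_setE /A/= in_itv/=; apply/negP; rewrite -leNgt.
  have [zB|zB] := ltP beta z.
    have -> : z \in B by rewrite inE /B/= in_itv/= andbT.
    have : (w <= u (hm + z))%R.
      by apply: u_homo; rewrite (le_trans z0_beta)// lerD2l ltW.
    by rewrite /=; lra.
  have -> : (z \in B) = false.
    by apply/negbTE; rewrite notin_setE /B/= in_itv/= andbT; apply/negP; rewrite -leNgt.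
  by rewrite /=; lra.
rewrite mulrBl mul1r EFinB addeA leeBrDr//.
have <- : \int[nu]_z ((u (hm + z)%R)%:E + c%:E) =
    \int[nu]_z (u (hm + z)%R)%:E + c%:E.
  rewrite -[in RHS](integral_probability_cst nu c); apply: ge0_integralD => //.
  by move=> z _; rewrite lee_fin.
apply: (@le_trans _ _ (\int[nu]_z ((u (hM + z)%R)%:E + (sA z + sB z)))); last first.
  apply: ge0_le_integral => //.
  - by move=> z _; rewrite adde_ge0 ?(proj2 uM)// adde_ge0 ?(proj2 mA) ?(proj2 mB).
  - exact: (proj1 (nneg_mfunD uM (nneg_mfunD mA mB))).
  - by apply: emeasurable_funD => //; exact: (proj1 um).
rewrite (nneg_integralD nu uM (nneg_mfunD mA mB)) (nneg_integralD nu mA mB).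
rewrite leeD2l//.
apply: le_trans (leeD iA iB); rewrite -EFinD lee_fin -mulrDr.
by rewrite le_eqVlt; apply/orP; left; apply/eqP; ring.
Qed.

End shock_contraction.

Section oscillation.
Variables (R : realType) (Phi : R -> R -> R) (h : R -> R) (lambda : R).
Variables (eta nu : probability R R).
Hypotheses (model : jump_model Phi h lambda eta) (lambda_gt0 : 0 < lambda).
Variables (hm hM delta : R).
Hypothesis h_bounds : forall x, hm <= h x <= hM.
Hypotheses (delta_gt0 : 0 < delta) (delta_le1 : delta <= 1).
Hypothesis nu_contraction : forall (u : R -> R) (l c : R),
  {homo u : x y / x <= y} -> 0 <= l -> (forall x, l <= u x <= l + c) ->
  (\int[nu]_z (u (hM + z)%R)%:E <=
   \int[nu]_z (u (hm + z)%R)%:E + ((1 - delta) * c)%:E)%E.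

Local Open Scope ereal_scope.
Implicit Types f : R -> \bar R.
Local Notation P_ t f := (fun x => income_op Phi h lambda eta nu f (x, t)).

Definition contraction_rate : R :=
  expR (- lambda) + (1 - delta) * (1 - expR (- lambda)).

Lemma contraction_rate_ge0 : (0 <= contraction_rate)%R.
Proof.
rewrite addr_ge0 ?expR_ge0// mulr_ge0 ?subr_ge0// expR_le1.
by rewrite oppr_le0 ltW.
Qed.

Lemma contraction_rate_lt1 : (contraction_rate < 1)%R.
Proof.
have e1 : (expR (- lambda) < 1)%R by rewrite expR_lt1 oppr_lt0.
have : (0 < delta * (1 - expR (- lambda)))%R by rewrite mulr_gt0 ?subr_gt0.
rewrite /contraction_rate; set e := expR _ => ?.
by lra.
Qed.

(** With probability [1 - expR (- lambda)] a jump occurs before time 1, and the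
    shock of the first jump shrinks the oscillation by [1 - delta]. *)
Lemma income_op_contract f (l c : R) : nneg_mfun f ->
  {homo f : x y / (x <= y)%R >-> x <= y} -> (0 <= l)%R -> (0 <= c)%R ->
  (forall x, l%:E <= f x <= (l + c)%:E) ->
  exists2 l' : R, (0 <= l')%R &
    forall x, l'%:E <= P_ 1%R f x <= (l' + contraction_rate * c)%:E.
Proof.
move=> fm f_homo l0 c0 flc; set U := income_op Phi h lambda eta nu f.
have Um : nneg_mfun U by exact: (nneg_mfun_income_op nu model fm).
have lc0 : (0 <= l + c)%R by rewrite addr_ge0.
have fl x : l%:E <= f x by case/andP: (flc x).
have fc x : f x <= (l + c)%:E by case/andP: (flc x).
have Ule y : U y <= (l + c)%:E := income_op_le nu model fm lc0 fc y.
have Uge y : (0 <= y.2)%R -> l%:E <= U y := @income_op_ge _ _ _ _ _ nu model _ _ fm l0 fl y.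
have Ufin y : U y \is a fin_num.
  by rewrite ge0_fin_numE ?(proj2 Um)// (le_lt_trans (Ule _)) ?ltry.
have Uhomo t : {homo (fun x => U (x, t)) : x y / (x <= y)%R >-> x <= y}.
  exact: (income_op_homo nu model t fm f_homo).
have m1 : measurable_fun setT (fun e : R => 1 - Num.max e 0)%R.
  by apply: measurable_funB => //; exact: measurable_max0.
have sm (a : R) : measurable_fun setT
    (fun p : R * R => ((a + p.2)%R, (1 - Num.max p.1 0)%R)).
  apply: measurable_fun_pair; first exact: measurable_funD.
  by apply: (measurableT_comp m1).
have Sm a := nneg_mfun_comp Um (sm a).
(* the expectation after a jump at time [e] from a point where [h] equals [a] *)
pose S (a e : R) := pintegral nu (fun p : R * R => U ((a + p.2)%R, (1 - Num.max p.1 0)%R)) e.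
have Slem a : nneg_mfun (S a) by exact: nneg_mfun_pintegral.
pose L := \int[eta]_e S hm e.
(* the loss of one shock, incurred only if the jump comes before time 1 *)
pose bump (e : R) : \bar R := ((1 - delta) * c)%:E * (\1_`]-oo, 1%R] e)%:E.
have d0 : (0 <= (1 - delta) * c)%R by rewrite mulr_ge0// subr_ge0.
have bm : nneg_mfun bump.
  split=> [|e]; last by rewrite mule_ge0 ?lee_fin.
  by apply: emeasurable_funM => //; exact/measurable_EFinP/measurable_indic.
have Sle e : S hM e <= S hm e + bump e.
  rewrite /bump indicE; have [e1|e1] := leP e 1%R.
    rewrite mem_set /= ?in_itv//= mule1.
    pose u z := fine (U (z, (1 - Num.max e 0)%R)).
    have uE z : (u z)%:E = U (z, (1 - Num.max e 0)%R) by rewrite fineK.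
    have r0 : (0 <= 1 - Num.max e 0)%R by rewrite subr_ge0 ge_max e1 ler01.
    have Su a : S a e = \int[nu]_z (u (a + z)%R)%:E.
      by apply: eq_integral => z _; rewrite uE.
    rewrite !Su; apply: (nu_contraction (l := l)) => //.
    - by move=> z1 z2 z12; rewrite -lee_fin !uE Uhomo.
    - by move=> z; rewrite -!lee_fin !uE Uge//= Ule.
  rewrite memNset /= ?in_itv/=; last by apply/negP; rewrite -ltNge.
  rewrite mule0 adde0 le_eqVlt; apply/orP; left; apply/eqP.
  have S0 a : S a e = 0.
    apply: integral0_eq => z _; apply: income_op_lt0 => /=.
    by rewrite subr_lt0 lt_max e1.
  by rewrite !S0.
have jm (x : R) := nneg_mfun_pair (x, 1%R : R) (nneg_mfun_pintegral nu (nneg_mfun_jump model Um)).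
have jm2 (x e : R) := nneg_mfun_pair (x, 1%R : R, e) (nneg_mfun_jump model Um).
have low x : L <= jump_op Phi h eta nu U (x, 1%R).
  apply: le_nneg_integral => // e.
  apply: le_nneg_integral => // [|z]; first exact: (nneg_mfun_pair e (Sm hm)).
  by apply: Uhomo; rewrite lerD2r; case/andP: (h_bounds (Phi x (Num.max e 0%R))).
have high x : jump_op Phi h eta nu U (x, 1%R) <=
    L + ((1 - delta) * c * (1 - expR (- lambda)))%:E.
  have <- : \int[eta]_e (S hm e + bump e) =
      L + ((1 - delta) * c * (1 - expR (- lambda)))%:E.
    rewrite (nneg_integralD eta (Slem hm) bm); congr (_ + _).
    by have := integral_eta_itv model d0 ler01; rewrite mulr1.
  apply: le_nneg_integral => // [|e]; first exact: nneg_mfunD.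
  apply: le_trans (Sle e).
  apply: le_nneg_integral => // [|z]; first exact: (nneg_mfun_pair e (Sm hM)).
  by apply: Uhomo; rewrite lerD2r; case/andP: (h_bounds (Phi x (Num.max e 0%R))).
have UE x : U (x, 1%R) =
    (expR (- lambda))%:E * f (Phi x 1%R) + jump_op Phi h eta nu U (x, 1%R).
  by rewrite {1}/U (income_opE nu model fm) no_jumpE// mulr1.
have Lfin : L \is a fin_num.
  rewrite ge0_fin_numE; last by apply: integral_ge0 => e _; exact: (proj2 (Slem hm)).
  apply: (le_lt_trans (low 0%R)); apply: (@le_lt_trans _ _ (U (0%R, 1%R))).
    by rewrite UE leeDr// mule_ge0 ?lee_fin ?expR_ge0 ?(proj2 fm).
  by rewrite (le_lt_trans (Ule _))// ltry.
have L0 : 0 <= L by apply: integral_ge0 => e _; exact: (proj2 (Slem hm)).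
clearbody L; case: L Lfin L0 low high => // L _ L0 low high.
have e0 : 0 <= (expR (- lambda))%:E by rewrite lee_fin expR_ge0.
exists (expR (- lambda) * l + L)%R.
  by rewrite addr_ge0 ?mulr_ge0 ?expR_ge0.
move=> x; rewrite UE; apply/andP; split.
  by rewrite EFinD EFinM (leeD (lee_wpmul2l e0 (fl _)) (low x)).
have -> : (expR (- lambda) * l + L + contraction_rate * c =
   expR (- lambda) * (l + c) + (L + (1 - delta) * c * (1 - expR (- lambda))))%R.
  by rewrite /contraction_rate; ring.
by rewrite EFinD EFinM (leeD (lee_wpmul2l e0 (fc _)) (high x)).
Qed.

(** Since [P_ (n + s) f = P_ s (P_ n f)] and each [P_ s] averages, the bounds
    valid at time [n] persist at all later times. *)
Lemma income_op_ergodic f n : nneg_mfun f ->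
  {homo f : x y / (x <= y)%R >-> x <= y} -> (forall x, f x <= 1) ->
  exists2 l : R, (0 <= l)%R & forall t x, (n%:R <= t)%R ->
    l%:E <= P_ t f x <= (l + contraction_rate ^+ n)%:E.
Proof.
move=> fm f_homo f1; have Um := nneg_mfun_income_op nu model fm.
have um t : nneg_mfun (P_ t f).
  by apply: (nneg_mfun_comp Um); exact: measurable_pair2.
suff [l l0 hl] : exists2 l : R, (0 <= l)%R & forall x,
    l%:E <= P_ n%:R f x <= (l + contraction_rate ^+ n)%:E.
  exists l => // t x nt; have s0 : (0 <= t - n%:R)%R by rewrite subr_ge0.
  rewrite -(subrK n%:R t) (income_op_semigroup nu model x (M := 1))//.
  have k0 : (0 <= contraction_rate ^+ n)%R.
    by rewrite exprn_ge0// contraction_rate_ge0.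
  apply/andP; split.
    by apply: (income_op_ge nu model) => // y; case/andP: (hl y).
  apply: (income_op_le nu model) => //; first exact: addr_ge0.
  by move=> y; case/andP: (hl y).
elim: n => [|n [l l0 IHn]].
  exists 0%R => // x; rewrite (proj2 (um _))/= expr0 add0r.
  exact: (income_op_le nu model).
have k0 : (0 <= contraction_rate ^+ n)%R.
  by rewrite exprn_ge0// contraction_rate_ge0.
have [l' l'0 hl'] := income_op_contract (um n%:R)
  (income_op_homo nu model n%:R fm f_homo) l0 k0 IHn.
exists l' => // x; rewrite exprS.
rewrite -natr1 addrC (income_op_semigroup nu model x (M := 1))//.
Qed.

(** The lower bounds of [income_op_ergodic] converge, since the interval for [n]
    and the interval for [m] meet at the time [max n m]; their supremum lies in all
    these intervals. *)
Lemma income_op_limit f : nneg_mfun f ->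
  {homo f : x y / (x <= y)%R >-> x <= y} -> (forall x, f x <= 1) ->
  exists L : R, forall n t x, (n%:R <= t)%R ->
    (L - contraction_rate ^+ n)%:E <= P_ t f x <= (L + contraction_rate ^+ n)%:E.
Proof.
move=> fm f_homo f1; set k := contraction_rate.
have /choice[l lP] n : exists l : R, forall t x, (n%:R <= t)%R ->
    l%:E <= P_ t f x <= (l + k ^+ n)%:E.
  by have [l _ hl] := income_op_ergodic n fm f_homo f1; exists l.
have k0 n : (0 <= k ^+ n)%R by rewrite exprn_ge0// contraction_rate_ge0.
have ll n m : (l n <= l m + k ^+ m)%R.
  have nm : (n%:R <= Num.max n%:R m%:R :> R)%R by rewrite le_max lexx.
  have mn : (m%:R <= Num.max n%:R m%:R :> R)%R by rewrite le_max lexx orbT.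
  have /andP[a _] := lP n _ 0%R nm; have /andP[_ b] := lP m _ 0%R mn.
  by rewrite -lee_fin (le_trans a b).
have ubl : has_ubound (range l) by exists (l 0%N + k ^+ 0%N)%R => _ [n _ <-].
exists (sup (range l)) => n t x nt; have /andP[a b] := lP n t x nt.
apply/andP; split.
  apply: le_trans a; rewrite lee_fin lerBlDr.
  by apply: ge_sup => [|_ [m _ <-]]; [exists (l 0%N), 0%N|].
apply: (le_trans b); rewrite lee_fin lerD2r.
by apply: ub_le_sup => //; exists n.
Qed.

End oscillation.

(** * Paths of the process *)

Section path.
Context d (Omega : measurableType d) (R : realType) (E : nat -> Omega -> R).
Hypothesis E_ge0 : forall n w, 0 <= E n w.
Implicit Types (t : R) (w : Omega).

Lemma jump_time0 w : jump_time E 0 w = 0.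
Proof. by rewrite /jump_time big_ord0. Qed.

Lemma jump_timeS n w : jump_time E n.+1 w = jump_time E n w + E n w.
Proof. by rewrite /jump_time big_ord_recr. Qed.

Lemma jump_time_homo w : {homo jump_time E ^~ w : m n / (m <= n)%N >-> m <= n}.
Proof.
move=> m n /subnKC <-; elim: (n - m)%N => [|k IHk]; first by rewrite addn0.
by rewrite addnS jump_timeS (le_trans IHk)// lerDl.
Qed.

Definition between_jumps t n : set Omega :=
  [set w | jump_time E n w <= t /\ t < jump_time E n.+1 w].

(** Here [jump_count] takes its default value. The event is negligible, but the
    process must be measurable on it too. *)
Definition explosion t : set Omega := [set w | forall n, jump_time E n w <= t].

Lemma between_jumpsE t n w : between_jumps t n w -> jump_count E t w = n.
Proof.
move=> [nt tn]; rewrite /jump_count; case: xgetP => [m -> [mt hm]|/(_ n)].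
  apply/eqP; rewrite eqn_leq hm// andbT leqNgt; apply/negP => nm.
  by have := lt_le_trans tn (jump_time_homo w nm); rewrite ltNge mt.
case; split => // m mt; rewrite leqNgt; apply/negP => nm.
by have := lt_le_trans tn (jump_time_homo w nm); rewrite ltNge mt.
Qed.

Lemma explosionE t w : explosion t w -> jump_count E t w = 0%N.
Proof.
move=> tw; rewrite /jump_count; case: xgetP => // m _ [_ /(_ m.+1 (tw _))].
by rewrite ltnn.
Qed.

Lemma trivIset_between_jumps t : trivIset setT (between_jumps t).
Proof.
apply/trivIsetP => m n _ _ /eqP mn; apply/seteqP; split => // w [].
by move=> /between_jumpsE mE /between_jumpsE nE; apply: mn; rewrite -mE -nE.
Qed.

Lemma between_jumps_cover t w : 0 <= t ->
  explosion t w \/ exists n, between_jumps t n w.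
Proof.
move=> t0; have [|ht] := pselect (explosion t w); [by left|right].
have [n tn] : exists n, t < jump_time E n w.
  apply: contra_notP ht => ht n; rewrite leNgt; apply/negP => tn.
  by apply: ht; exists n.
have ex : exists n, t < jump_time E n w by exists n.
case: (ex_minnP ex) => -[|m] tm hm; first by rewrite jump_time0 ltNge t0 in tm.
exists m; split => //; rewrite leNgt; apply/negP => /hm.
by rewrite ltnn.
Qed.

End path.

Section measurable_path.
Context d (T : measurableType d) (R : realType) (Phi : R -> R -> R) (h : R -> R).
Hypothesis measurable_Phi :
  measurable_fun setT (fun p : R * R => Phi p.1 (Num.max p.2 0)).
Hypothesis h_homo : {homo h : x y / x <= y}.
Variables (E zeta : nat -> T -> R) (X0 : T -> R).
Hypothesis E_ge0 : forall n w, 0 <= E n w.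
Hypothesis measurable_E : forall n, measurable_fun setT (E n).
Hypothesis measurable_zeta : forall n, measurable_fun setT (zeta n).
Hypothesis measurable_X0 : measurable_fun setT X0.

Lemma measurable_jump_time n : measurable_fun setT (jump_time E n).
Proof. exact: measurable_sum. Qed.

Lemma measurable_jump_state n :
  measurable_fun setT (jump_state Phi h E zeta X0 n).
Proof.
elim: n => //= n IHn; apply: measurable_funD => //.
apply: (measurableT_comp (nondecreasing_measurable measurableT h_homo)).
rewrite (_ : (fun _ => _) = (fun p : R * R => Phi p.1 (Num.max p.2 0)) \o
  (fun w => (jump_state Phi h E zeta X0 n w, E n w))); last first.
  by apply/funext => w /=; rewrite max_l.
by apply: measurableT_comp => //; exact: measurable_fun_pair.
Qed.

Lemma measurable_between_jumps t n : measurable (between_jumps E t n).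
Proof.
rewrite [X in measurable X](_ : _ = jump_time E n @^-1` `]-oo, t] `&`
    jump_time E n.+1 @^-1` `]t, +oo[).
  by apply: measurableI; rewrite -[X in measurable X]setTI;
    apply: measurable_jump_time.
by apply/seteqP; split => w /=; rewrite !in_itv/= andbT.
Qed.

Lemma measurable_explosion t : measurable (explosion E t).
Proof.
rewrite [X in measurable X](_ : _ = \bigcap_n (jump_time E n @^-1` `]-oo, t])).
  apply: bigcap_measurable => [|n _]; first by exists 0%N.
  by rewrite -[X in measurable X]setTI; exact: measurable_jump_time.
by apply/seteqP; split => w /= H n; [move=> _|]; move: (H n); rewrite /= in_itv/=;
  exact.
Qed.

(** The position at [t] if exactly [n] jumps occur before [t], with a truncated time
    so that it is measurable on the whole space. *)
Definition flow_after_jump t n w :=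
  Phi (jump_state Phi h E zeta X0 n w) (Num.max (t - jump_time E n w) 0).

Lemma measurable_flow_after_jump t n : measurable_fun setT (flow_after_jump t n).
Proof.
have mt : measurable_fun setT (fun w => t - jump_time E n w).
  by apply: measurable_funB => //; exact: measurable_jump_time.
exact: (measurableT_comp measurable_Phi
  (measurable_fun_pair (measurable_jump_state n) mt)).
Qed.

Lemma log_income_between t n w : between_jumps E t n w ->
  log_income Phi h E zeta X0 t w = flow_after_jump t n w.
Proof.
move=> nw; rewrite /log_income (between_jumpsE E_ge0 nw) /flow_after_jump max_l//.
by rewrite subr_ge0; case: nw.
Qed.

Lemma log_income_explosion t w : 0 <= t -> explosion E t w ->
  log_income Phi h E zeta X0 t w = flow_after_jump t 0 w.
Proof.
move=> t0 tw; rewrite /log_income (explosionE tw) /flow_after_jump jump_time0.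
by rewrite subr0 max_l.
Qed.

Lemma measurable_log_income t : 0 <= t ->
  measurable_fun setT (log_income Phi h E zeta X0 t).
Proof.
move=> t0 _ B mB; rewrite setTI.
rewrite [X in measurable X](_ : _ =
    \bigcup_n (between_jumps E t n `&` flow_after_jump t n @^-1` B) `|`
    (explosion E t `&` flow_after_jump t 0 @^-1` B)).
  have mf n : measurable (flow_after_jump t n @^-1` B).
    by rewrite -[X in measurable X]setTI; exact: measurable_flow_after_jump.
  apply: measurableU; last first.
    by apply: measurableI => //; exact: measurable_explosion.
  apply: bigcup_measurable => n _; apply: measurableI => //.
  exact: measurable_between_jumps.
apply/seteqP; split => w /=.
  have [ew|[n nw]] := between_jumps_cover E w t0.
    by rewrite log_income_explosion//; right.
  by rewrite (log_income_between nw); left; exists n.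
move=> [[n _ [nw]]|[ew]] /=; first by rewrite (log_income_between nw).
by rewrite log_income_explosion.
Qed.

End measurable_path.

(** * Independence *)

Definition mfun_of d d' (T : measurableType d) (U : measurableType d')
    (f : T -> U) (mf : measurable_fun setT f) : {mfun T >-> U} :=
  HB.pack f (isMeasurableFun.Build _ _ _ _ f mf).

Lemma eq_measure_rectangles d d' (T : measurableType d) (U : measurableType d')
    (R : realType) (m1 m2 : {measure set (T * U) -> \bar R}) :
  (forall D C, measurable D -> measurable C -> m1 (D `*` C) = m2 (D `*` C)) ->
  (m1 setT < +oo)%E -> forall A, measurable A -> m1 A = m2 A.
Proof.
move=> m12 m1oo A mA.
pose G : set (set (T * U)) :=
  [set A `*` B | A in measurable & B in measurable].
apply: (measure_unique G (fun=> setT)) => //.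
- by rewrite measurable_prod_measurableType.
- move=> _ _ [A1 mA1 [B1 mB1 <-]] [A2 mA2 [B2 mB2 <-]]; rewrite -setXI.
  by exists (A1 `&` A2); [exact: measurableI|exists (B1 `&` B2) => //; exact: measurableI].
- by move=> _; exists setT => //; exists setT => //; rewrite setXTT.
- by rewrite bigcup_const//; exists 0%N.
- by move=> _ [D mD [C mC <-]]; exact: m12.
Qed.

Section independence.
Context d (Omega : measurableType d) (R : realType) (P : probability Omega R).
Variables (I : eqType) (X : I -> {RV P >-> R}).
Local Open Scope ereal_scope.

Definition cylinder (s : seq I) (B : I -> set R) : set Omega :=
  \big[setI/setT]_(i <- s) (X i @^-1` B i).

(** Independence of [Y] from the variables with index in [Q], and of the latter from
    each other. This strong form, with [Q] decreasing, is an invariant of the jump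
    chain. *)
Definition independent_of d' (T : measurableType d') (Y : Omega -> T)
    (Q : pred I) : Prop :=
  forall (s : seq I) (B : I -> set R) (D : set T), uniq s -> all Q s ->
    (forall i, measurable (B i)) -> measurable D ->
    P (Y @^-1` D `&` cylinder s B) =
    P (Y @^-1` D) * \prod_(i <- s) P (X i @^-1` B i).

Lemma measurable_cylinder s B : (forall i, measurable (B i)) ->
  measurable (cylinder s B).
Proof.
move=> mB; rewrite /cylinder; elim: s => [|i s IHs].
  by rewrite big_nil.
by rewrite big_cons; apply: measurableI => //; exact: measurable_funPTI.
Qed.

Context d' (T : measurableType d').
Implicit Types (Y : Omega -> T) (Q : pred I).

Lemma independent_of_cst (y : T) Q : mutually_independent X ->
  independent_of (cst y) Q.
Proof.
move=> indX s B D us _ mB mD; have PS := indX s B us mB.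
have [yD|yD] := pselect (D y).
  rewrite [_ @^-1` _](_ : _ = setT); last by apply/seteqP; split.
  by rewrite setTI probability_setT mul1e; exact: PS.
rewrite [_ @^-1` _](_ : _ = set0); last by apply/seteqP; split.
by rewrite set0I measure0 mul0e.
Qed.

Lemma independent_of_comp d2 (U : measurableType d2) (psi : T -> U) Y Q Q' :
  measurable_fun setT psi -> (forall i, Q' i -> Q i) ->
  independent_of Y Q -> independent_of (fun w => psi (Y w)) Q'.
Proof.
move=> mpsi QQ iY s B D us Qs mB mD.
have mD' : measurable (psi @^-1` D) by rewrite -[X in measurable X]setTI; exact: mpsi.
by apply: (iY s B _ us _ mB mD'); exact: sub_all Qs.
Qed.

Lemma independent_of_rectangle Y Q j : independent_of Y Q -> Q j ->
  forall (s : seq I) (B : I -> set R) D C, uniq s -> all Q s -> j \notin s ->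
    (forall i, measurable (B i)) -> measurable D -> measurable C ->
    P ((Y @^-1` D `&` X j @^-1` C) `&` cylinder s B) =
    P (Y @^-1` D) * P (X j @^-1` C) * \prod_(i <- s) P (X i @^-1` B i).
Proof.
move=> iY Qj s B D C us Qs js mB mD mC.
(* the indices in [s] differ from [j], so the value of [B] at [j] is free *)
pose B' i := if i == j then C else B i.
have B'E i : i \in s -> B' i = B i.
  by move=> si; rewrite /B'; case: eqP => // ij; rewrite -ij si in js.
have mB' i : measurable (B' i) by rewrite /B'; case: ifP.
have := iY (j :: s) B' D; rewrite /= js us Qj Qs => /(_ isT isT mB' mD).
have B'j : B' j = C by rewrite /B' eqxx.
have -> : cylinder (j :: s) B' = X j @^-1` C `&` cylinder s B.
  rewrite /cylinder big_cons B'j; congr (_ `&` _).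
  by apply: eq_big_seq => i si; rewrite B'E.
have -> : \prod_(i <- j :: s) P (X i @^-1` B' i) =
    P (X j @^-1` C) * \prod_(i <- s) P (X i @^-1` B i).
  rewrite big_cons B'j; congr (_ * _).
  by apply: eq_big_seq => i si; rewrite B'E.
by rewrite setIA muleA.
Qed.

Lemma independent_of_nil Y Q D C j : independent_of Y Q -> Q j ->
  measurable D -> measurable C ->
  P (Y @^-1` D `&` X j @^-1` C) = P (Y @^-1` D) * P (X j @^-1` C).
Proof.
move=> iY Qj mD mC.
have := @independent_of_rectangle Y Q j iY Qj [::] (fun=> setT) D C.
rewrite /cylinder !big_nil setIT mule1; exact.
Qed.

(** A variable [X j] may be moved from the future [Q] to the present [Y]. On a
    cylinder of the remaining variables, the law of the pair is compared on
    rectangles with its unrestricted law scaled by the mass of the cylinder. *)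
Lemma independent_of_pair Y Q Q' j : measurable_fun setT Y ->
  (forall i, Q' i -> Q i && (i != j)) -> Q j ->
  independent_of Y Q -> independent_of (fun w => (Y w, X j w)) Q'.
Proof.
move=> mY QQ' Qj iY s B D us Qs mB mD.
have mX : measurable_fun setT (X j) by exact: measurable_funPT.
have mYX : measurable_fun setT (fun w => (Y w, X j w)).
  exact: measurable_fun_pair.
have Qs' : all Q s by apply: sub_all Qs => i /QQ' /andP[].
have js : j \notin s.
  by apply/negP => sj; have := allP Qs _ sj => /QQ'; rewrite eqxx andbF.
have mS := measurable_cylinder s mB.
have PS : P (cylinder s B) = \prod_(i <- s) P (X i @^-1` B i).
  have := iY s B setT us Qs' mB measurableT.
  by rewrite preimage_setT setTI probability_setT mul1e.
have p0 : (0 <= fine (P (cylinder s B)))%R by rewrite fine_ge0.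
pose m1 := measure_function_pushforward__canonical__measure_function_Measure
  (mrestr P mS) mYX.
pose m2 := mscale (NngNum p0) (distribution P (mfun_of mYX)).
have m12 : m1 D = m2 D.
  apply: eq_measure_rectangles => // [A C mA mC|]; last first.
    rewrite /m1 /= /pushforward /mrestr preimage_setT setTI.
    by rewrite (le_lt_trans (probability_le1 _ _))// ltry.
  have dAC : distribution P (mfun_of mYX) (A `*` C) =
      P (Y @^-1` A) * P (X j @^-1` C) by exact: (independent_of_nil iY Qj mA mC).
  rewrite /m1 /m2 /= /mscale/= dAC fineK ?fin_num_measure// muleC PS.
  exact: (independent_of_rectangle iY Qj us Qs' js mB mA mC).
rewrite -PS muleC -[P (cylinder s B)]fineK ?fin_num_measure//; exact: m12.
Qed.

(** The law of [(Y, X j)] is a product measure, so Tonelli's theorem applies. *)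
Lemma integral_independent_of Y Q j (F : T * R -> \bar R) :
  measurable_fun setT Y -> independent_of Y Q -> Q j -> nneg_mfun F ->
  \int[P]_w F (Y w, X j w) = \int[P]_w pintegral (distribution P (X j)) F (Y w).
Proof.
move=> mY iY Qj Fm.
have mX : measurable_fun setT (X j) by exact: measurable_funPT.
have mYX : measurable_fun setT (fun w => (Y w, X j w)).
  exact: measurable_fun_pair.
have pm := nneg_mfun_pintegral (distribution P (X j)) Fm.
have [mF F0] := Fm; have [mp p0] := pm.
have <- : \int[distribution P (mfun_of mYX)]_z F z = \int[P]_w F (Y w, X j w).
  by rewrite ge0_integral_distribution.
have <- : \int[distribution P (mfun_of mY)]_y pintegral (distribution P (X j)) F y =
    \int[P]_w pintegral (distribution P (X j)) F (Y w).
  by rewrite ge0_integral_distribution.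
rewrite -fubini_tonelli1//; apply: eq_measure_integral => A mA _; apply/esym.
apply: (@product_measure_unique _ _ _ _ _ (distribution P (mfun_of mY))
  (distribution P (X j)) (distribution P (mfun_of mYX))) => // B C mB mC.
exact: (independent_of_nil iY Qj mB mC).
Qed.

End independence.

(** * The law of the process *)

Section income_law.
Context (R : realType) (Phi : R -> R -> R) (h : R -> R) (lambda : R).
Context (nu : probability R R) d (Omega : measurableType d).
Context (P : probability Omega R) (E zeta : nat -> {RV P >-> R}).
Hypothesis driver : income_driver lambda nu E zeta.

Let eta : probability R R := distribution P (E 0%N).

Lemma distribution_waiting_tail t : 0 <= t ->
  distribution P (E 0%N) `]t, +oo[%classic = (expR (- lambda * t))%:E.
Proof.
move=> t0; have E0 := waiting_ge0 driver 0%N.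
have -> : distribution P (E 0%N) `]t, +oo[%classic =
    (1 - distribution P (E 0%N) `]-oo, t]%classic)%E.
  by rewrite -setCitvl; apply: probability_setC.
have -> : distribution P (E 0%N) `]-oo, t]%classic = exponential_prob lambda `[0, t].
  rewrite -(waiting_law driver 0%N)//.
  by congr (P _); apply/seteqP; split => w /=; rewrite !in_itv/= ?E0// => /andP[].
move: t0; rewrite le_eqVlt => /predU1P[<-|t0].
  rewrite mulr0 expR0 set_itv1 /exponential_prob integral_set1.
  by rewrite sube0.
rewrite exponential_prob_itv0c// -!EFinB; congr EFin; ring.
Qed.

Hypothesis model : jump_model Phi h lambda eta.

Definition driver_var (i : nat + nat) : {RV P >-> R} :=
  match i with inl n => E n | inr n => zeta n end.

Definition from_step (n : nat) : pred (nat + nat) :=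
  fun i => match i with inl m => (n <= m)%N | inr m => (n <= m)%N end.

(** The second coordinate is the time left until [t]: with it the chain is
    homogeneous, which makes the renewal equation available at every [t]. *)
Definition chain (x t : R) (n : nat) (w : Omega) : R * R :=
  (jump_state Phi h E zeta (cst x) n w, t - jump_time E n w).

Lemma chainS x t n w :
  chain x t n.+1 w = jump_step Phi h (chain x t n w) (E n w) (zeta n w).
Proof.
rewrite /chain /jump_step jump_timeS /= (max_l (waiting_ge0 driver n w)).
by congr pair; ring.
Qed.

Lemma measurable_chain x t n : measurable_fun setT (chain x t n).
Proof.
apply: measurable_fun_pair.
  apply: (measurable_jump_state (measurable_Phi model) (h_homo model)) => //.
  exact: waiting_ge0 driver.
by apply: measurable_funB => //; exact: measurable_jump_time.
Qed.

Lemma measurable_chain_waiting x t n :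
  measurable_fun setT (fun w => (chain x t n w, driver_var (inl n) w)).
Proof.
apply: measurable_fun_pair; first exact: measurable_chain.
exact: measurable_funPT.
Qed.

Definition from_shock n : pred (nat + nat) :=
  predI (from_step n) (predC1 (inl n)).

Lemma independent_chain_waiting x t n :
  independent_of driver_var (chain x t n) (from_step n) ->
  independent_of driver_var (fun w => (chain x t n w, driver_var (inl n) w))
    (from_shock n).
Proof.
apply: independent_of_pair => //=; first exact: measurable_chain.
Qed.

Lemma independent_chain x t n :
  independent_of driver_var (chain x t n) (from_step n).
Proof.
elim: n => [|n IHn].
  rewrite (_ : chain x t 0 = cst (x, t)).
    by apply: independent_of_cst; exact: driver_independent driver.
  by apply/funext => w; rewrite /chain jump_time0 subr0.
pose psi (p : R * R * R * R) := jump_step Phi h p.1.1 p.1.2 p.2.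
rewrite (_ : chain x t n.+1 = fun w =>
  psi ((chain x t n w, driver_var (inl n) w), driver_var (inr n) w)); last first.
  by apply/funext => w; rewrite chainS.
apply: (independent_of_comp (Q := from_step n.+1)) => //.
  exact: measurable_jump_step model.
apply: (independent_of_pair (Q := from_shock n)).
- exact: measurable_chain_waiting.
- move=> i ni; apply/andP; split; [apply/andP; split|].
  + by case: i ni => m; exact: ltnW.
  + by apply: contraTneq ni => ->; rewrite /= ltnn.
  + by apply: contraTneq ni => ->; rewrite /= ltnn.
- by rewrite /from_shock /= leqnn.
exact: independent_chain_waiting.
Qed.

Lemma distribution_waiting n : forall B, measurable B ->
  distribution P (E n) B = eta B.
Proof.
by move=> B mB; rewrite (waiting_law driver n mB) -(waiting_law driver 0%N mB).
Qed.

Local Open Scope ereal_scope.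

(** Jumps are peeled off at the end, where the shock and then the waiting time are
    independent of the past; [iterSr] turns this into an application of [jump_op] at
    the innermost place. *)
Lemma integral_chain x t n F : nneg_mfun F ->
  \int[P]_w F (chain x t n w) = iter n (jump_op Phi h eta nu) F (x, t).
Proof.
elim: n F => [|n IHn] F Fm.
  rewrite (_ : chain x t 0 = cst (x, t)) /=; last first.
    by apply/funext => w; rewrite /chain jump_time0 subr0.
  rewrite integral_cst// -[RHS]mule1; congr (_ * _); exact: probability_setT.
rewrite iterSr -IHn; last exact: (nneg_mfun_jump_op nu model Fm).
pose G (p : R * R * R * R) := F (jump_step Phi h p.1.1 p.1.2 p.2).
have Gm : nneg_mfun G := nneg_mfun_jump model Fm.
pose G1 := pintegral (distribution P (zeta n)) G.
have G1m : nneg_mfun G1 by exact: nneg_mfun_pintegral.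
transitivity (\int[P]_w G ((chain x t n w, driver_var (inl n) w), driver_var (inr n) w)).
  by apply: eq_integral => w _; rewrite chainS.
have iC := @independent_chain x t n; have iCE := independent_chain_waiting iC.
have shock_n : from_shock n (inr n) by rewrite /from_shock /= leqnn.
rewrite (integral_independent_of (measurable_chain_waiting x t n) iCE shock_n Gm).
have wait_n : from_step n (inl n) by exact: leqnn.
rewrite (integral_independent_of (measurable_chain x t n) iC wait_n G1m).
apply: eq_integral => w _; apply: etrans.
  by apply: (eq_measure_integral eta) => A mA _; exact: distribution_waiting.
apply: eq_integral => e _; apply: (eq_measure_integral nu) => A mA _.
exact: shock_law driver _ _ mA.
Qed.

(** Exactly [n] jumps occur before [t] when the [n]-th one does and the next waiting
    time exceeds the time left, which has probability [expR (- lambda * r)] when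
    [r >= 0] is left. *)
Lemma integral_between_jumps x t n f : nneg_mfun f ->
  \int[P]_(w in between_jumps E t n) f (flow_after_jump Phi h E zeta (cst x) t n w) =
  iter n (jump_op Phi h eta nu) (no_jump Phi lambda f) (x, t).
Proof.
move=> fm; have Gm := nneg_mfun_no_jump model fm.
rewrite -integral_chain//.
pose H (p : R * R * R) : \bar R :=
  if (0 <= p.1.2)%R && (p.1.2 < p.2)%R then f (Phi p.1.1 (Num.max p.1.2 0%R)) else 0.
have Hm : nneg_mfun H.
  have m12 : measurable_fun setT (fun p : R * R * R => p.1.2).
    exact: measurableT_comp.
  split; last by move=> p; rewrite /H; case: ifP => // _; exact: (proj2 fm).
  apply: measurable_fun_ifT => //.
  - by apply: measurable_and; [exact: measurable_fun_ler|exact: measurable_fun_ltr].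
  - apply: (measurableT_comp (proj1 fm)).
    by apply: (measurableT_comp (measurable_Phi model)); exact: measurable_fst.
transitivity (\int[P]_w H (chain x t n w, driver_var (inl n) w)).
  rewrite integral_mkcond; apply: eq_integral => w _; rewrite patchE /H /=.
  rewrite subr_ge0 ltrBlDl -jump_timeS; case: ifPn.
    by rewrite inE => -[-> ->].
  rewrite notin_setE => wn; case: ifP => // /andP[tn nt].
  by exfalso; apply: wn.
have wait_n : from_step n (inl n) by exact: leqnn.
rewrite (integral_independent_of (measurable_chain x t n) (@independent_chain x t n)
  wait_n Hm).
apply: eq_integral => w _; move: (chain x t n w) => [z r].
rewrite /pintegral (eq_measure_integral eta) => [|A mA _]; last first.
  exact: distribution_waiting.
rewrite /no_jump /H /=; case: ifPn => r0 /=; last by rewrite integral0.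
transitivity (\int[eta]_e (f (Phi z (Num.max r 0%R)) * (\1_`]r, +oo[ e)%:E)).
  apply: eq_integral => e _; rewrite indicE.
  case: ifPn => re; first by rewrite mem_set /= ?in_itv/= ?andbT// mule1.
  by rewrite memNset /= ?in_itv/= ?andbT ?mule0//; apply/negP.
rewrite ge0_integralZl//; last 2 first.
- exact/measurable_EFinP/measurable_indic.
- exact: (proj2 fm).
rewrite integral_indic// setIT muleC; congr (_ * _).
exact: distribution_waiting_tail.
Qed.

(** Almost surely the process does not explode, so the events [between_jumps t n]
    split the expectation according to the number of jumps before [t]. *)
Lemma integral_log_income x t f : (0 <= t)%R -> nneg_mfun f ->
  \int[P]_w f (log_income Phi h E zeta (cst x) t w) =
  income_op Phi h lambda eta nu f (x, t).
Proof.
move=> t0 fm.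
have E0 := waiting_ge0 driver.
have mE n : measurable_fun setT (E n) by exact: measurable_funPT.
have mX : measurable_fun setT (log_income Phi h E zeta (cst x) t).
  exact: (measurable_log_income (measurable_Phi model) (h_homo model)).
have mA n := measurable_between_jumps mE t n.
have mN := measurable_explosion mE t.
pose V (y : R * R) : \bar R := if (0 <= y.2)%R then 1 else 0.
have Vm : nneg_mfun V.
  split; last by move=> y; rewrite /V; case: ifP.
  by apply: measurable_fun_ifT => //; exact: measurable_fun_ler.
have PN : P (explosion E t) = 0.
  apply/eqP; rewrite eq_le measure_ge0 andbT; apply/lee_addgt0Pr => e e0.
  rewrite add0e.
  have [n qn] := expr_lt_eventually 1 (jump_prob_lt1 model t0) e0.
  apply: (@le_trans _ _ (iter n (jump_op Phi h eta nu) V (x, t))); last first.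
    apply: (@le_trans _ _ (1 * (1 - expR (- lambda * t)) ^+ n)%:E).
      apply: (iter_jump_op_le nu model Vm) => //.
      - by move=> y; rewrite /V; case: ifP.
      - by move=> y; rewrite /V ltNge => /negbTE ->.
    by rewrite lee_fin ltW.
  rewrite -integral_chain//.
  rewrite -[leLHS](_ : \int[P]_w (\1_(explosion E t) w)%:E = _); last first.
    by rewrite integral_indic// setIT.
  apply: le_nneg_integral.
  - split=> [|w]; last by rewrite lee_fin.
    exact/measurable_EFinP/measurable_indic.
  - by apply: (nneg_mfun_comp Vm); exact: measurable_chain.
  - move=> w; rewrite indicE; case: (boolP (w \in _)) => [|_]; last first.
      exact: (proj2 Vm).
    by rewrite inE => /(_ n) wn; rewrite /V /= subr_ge0 wn.
have fXm : measurable_fun setT (fun w => f (log_income Phi h E zeta (cst x) t w)).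
  exact: measurableT_comp (proj1 fm) mX.
rewrite (@ge0_negligible_integral _ _ _ _ _ (explosion E t))//; last first.
  by move=> w _; exact: (proj2 fm).
rewrite (_ : setT `\` explosion E t = \bigcup_n between_jumps E t n); last first.
  apply/seteqP; split => w.
    by move=> [_ nw]; have [//|[n]] := between_jumps_cover E w t0; exists n.
  move=> [n _ [tn nt]]; split => // /(_ n.+1).
  by rewrite leNgt nt.
rewrite ge0_integral_bigcup//.
- apply: eq_eseriesr => n _; rewrite -integral_between_jumps//.
  apply: eq_integral => w; rewrite inE => nw.
  by rewrite (log_income_between Phi h zeta (cst x) E0 nw).
- exact: measurable_funTS.
- by move=> w _; exact: (proj2 fm).
- exact: trivIset_between_jumps.
Qed.

End income_law.

(** * Probability measures and distribution functions *)

(** The Lebesgue-Stieltjes measure lives on an alias of [R] with its own measurable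
    structure; its image under the identity is a measure on [R] itself. *)
Lemma probability_of_cdf (R : realType) (F : R -> R) :
  {homo F : x y / x <= y} -> (forall a, F x @[x --> a^'+] --> F a) ->
  F x @[x --> -oo] --> (0 : R) -> F x @[x --> +oo] --> (1 : R) ->
  exists mu : probability R R, forall a, mu `]-oo, a]%classic = (F a)%:E.
Proof.
move=> Fnd Frc FNy Fy.
pose f : cumulativeBounded (0 : R) (1 : R) := HB.pack F (isCumulative.Build R _ R F Fnd Frc)
  (isCumulativeBounded.Build R 0 1 F FNy Fy).
pose idR : measurableTypeR R -> R := idfun.
have mid : measurable_fun setT idR by exact: measurable_id.
exists (distribution (lebesgue_stieltjes_measure f) (mfun_of mid)) => a.
exact: (cdf_lebesgue_stieltjes_id f a).
Qed.

Section up_sets.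
Variables (R : realType).
Implicit Types (D : set R).
Local Open Scope ereal_scope.

Definition up_set D : Prop := forall x y, (x <= y)%R -> D x -> D y.

Lemma up_set_cases D : up_set D ->
  [\/ D = set0, D = setT, exists a, D = `]a, +oo[%classic |
      exists a, D = `[a, +oo[%classic].
Proof.
move=> upD; have [D0|/set0P[x Dx]] := eqVneq D set0; first by constructor 1.
have [lD|nlD] := pselect (has_lbound D); last first.
  constructor 2; apply/seteqP; split => // y _.
  apply: contra_notP nlD => nDy; exists y => z Dz.
  by rewrite leNgt; apply/negP => /ltW zy; apply: nDy; exact: upD Dz.
have iD : has_inf D by split; [exists x|].
have gtD y : (inf D < y)%R -> D y.
  rewrite -subr_gt0 => iy; have [z Dz] := inf_adherent iy iD.
  rewrite addrC subrK => zy.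
  exact: upD (ltW zy) Dz.
have geD y : D y -> (inf D <= y)%R by move=> Dy; exact: ge_inf.
have [Di|nDi] := pselect (D (inf D)).
  constructor 4; exists (inf D); apply/seteqP; split => y /=; rewrite in_itv/= andbT.
    exact: geD.
  by move=> iy; exact: upD iy Di.
constructor 3; exists (inf D); apply/seteqP; split => y /=; rewrite in_itv/= andbT.
  move=> Dy; rewrite lt_neqAle geD// andbT; apply/negP => /eqP iy.
  by apply: nDi; rewrite iy.
exact: gtD.
Qed.

Variables (mu nu : probability R R) (e : R).
Hypothesis e_ge0 : (0 <= e)%R.
Hypothesis mu_nu : forall a : R,
  mu `]a, +oo[%classic <= nu `]a, +oo[%classic + e%:E.

(** A closed ray is a decreasing intersection of open ones. *)
Lemma le_measure_up_set D : up_set D -> mu D <= nu D + e%:E.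
Proof.
have e0 : 0 <= e%:E by rewrite lee_fin.
move=> /up_set_cases[->|->|[a ->]|[a ->]].
- by rewrite !measure0 add0e.
- by have -> := @probability_setT _ _ _ mu; have -> := @probability_setT _ _ _ nu;
    rewrite leeDl.
- exact: mu_nu.
pose Dn n : set R := `](a - n.+1%:R^-1)%R, +oo[%classic.
have mDn n : measurable (Dn n) by exact: measurable_itv.
have capDn : \bigcap_n Dn n = `[a, +oo[%classic.
  apply/seteqP; split => x /=; rewrite /Dn /= in_itv/= andbT.
    move=> Dx; rewrite leNgt; apply/negP => xa.
    have /ltr_add_invr[n] : (x < a)%R by [].
    have := Dx n I; rewrite /= in_itv/= andbT ltrBlDr => ax xna.
    by have := lt_trans ax xna; rewrite ltxx.
  by move=> ax n _ /=; rewrite in_itv/= andbT (lt_le_trans _ ax)// ltrBlDr ltrDl.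
have cD : nu (Dn n) @[n --> \oo] --> nu `[a, +oo[%classic.
  rewrite -capDn; apply: nonincreasing_cvg_mu => //.
  - by rewrite -ge0_fin_numE// fin_num_measure.
  - by rewrite capDn; exact: measurable_itv.
  - move=> m n mn; apply/subsetPset => x /=; rewrite /Dn /= !in_itv/= !andbT.
    by apply: le_lt_trans; rewrite lerD2l lerN2 lef_pV2 ?posrE// ler_nat.
have cDe : nu (Dn n) + e%:E @[n --> \oo] --> nu `[a, +oo[%classic + e%:E.
  by apply: cvgeD => //; [exact: fin_num_adde_defl|exact: cvg_cst].
apply: (cvge_to_ge cDe); near=> n; apply: le_trans (mu_nu _).
apply: le_measure; rewrite ?inE//.
by move=> x /=; rewrite !in_itv/= !andbT; apply: lt_le_trans; rewrite ltrBlDr ltrDl.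
Unshelve. all: by end_near. Qed.

(** By the layer-cake formula, the integral of [u] is that of the measures of its
    superlevel sets, which are up-sets; the errors [e] add up over the levels in
    [`[0, 1]] only, as [u <= 1]. *)
Lemma le_integral_homo (u : R -> R) : {homo u : x y / (x <= y)%R} ->
  (forall x, (0 <= u x <= 1)%R) ->
  \int[mu]_x (u x)%:E <= \int[nu]_x (u x)%:E + e%:E.
Proof.
move=> u_homo u01.
have mu_ : measurable_fun setT u by exact: nondecreasing_measurable.
pose U : {mfun R >-> R} := mfun_of mu_.
have U0 x : (0 <= U x)%R by case/andP: (u01 x).
have ue (m : probability R R) : \int[m]_x (u x)%:E =
    \int[lebesgue_measure]_(r in `[0%R, +oo[) m [set x | (r < u x)%R].
  transitivity ('E_m[U]); first by rewrite unlock.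
  rewrite (ge0_expectation_ccdf (X := U : {RV m >-> R}))//.
  apply: eq_integral => r _; rewrite /ccdf /distribution /pushforward.
  by congr (m _); apply/seteqP; split => x /=; rewrite in_itv/= andbT.
have ms (m : probability R R) : measurable_fun (`[0%R, +oo[%classic : set R)
    (fun r : R => m [set x | (r < u x)%R]).
  apply: measurable_funTS.
  apply: eq_measurable_fun (ccdf_measurable (U : {RV m >-> R})) => r _.
  rewrite /ccdf /distribution /pushforward.
  by congr (m _); apply/seteqP; split => x /=; rewrite in_itv/= andbT.
rewrite !ue.
have <- : \int[lebesgue_measure]_(r in `[0%R, +oo[)
    (e%:E * (\1_`[0%R, 1%R] r)%:E) = e%:E :> \bar R.
  rewrite ge0_integralZl_EFin//; last exact/measurable_EFinP/measurable_indic.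
  rewrite integral_indic//= setIidl; last by move=> x /=; rewrite !in_itv/= => /andP[->].
  by rewrite lebesgue_measure_itv/= lte_fin ltr01 sube0 mule1.
have mi : measurable_fun (`[0%R, +oo[%classic : set R)
    (fun r : R => e%:E * (\1_`[0%R, 1%R] r)%:E).
  by apply: emeasurable_funM => //; exact/measurable_EFinP/measurable_indic.
have i0 (r : R) : 0 <= e%:E * (\1_(`[0%R, 1%R]%classic : set R) r)%:E.
  by rewrite mule_ge0// lee_fin.
rewrite -ge0_integralD//=; last exact: ms.
apply: ge0_le_integral => //=; [exact: ms|exact: emeasurable_funD (ms _) mi|].
move=> r; rewrite in_itv/= andbT => r0.
have [r1|r1] := leP r 1%R.
  rewrite indicE mem_set /= ?in_itv/= ?r0// mule1.
  by apply: le_measure_up_set => x y xy /= /lt_le_trans; apply; exact: u_homo.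
rewrite (_ : [set x | (r < u x)%R] = set0) ?measure0 ?adde_ge0 ?mule_ge0 ?lee_fin//.
apply/seteqP; split => // x /=; apply/negP; rewrite -leNgt.
by case/andP: (u01 x) => _ /le_trans; apply; exact: ltW.
Qed.

End up_sets.

(** * Existence and uniqueness of the limit *)

Lemma cvg_uniform_approx (R : realType) (T : Type) (F : set_system T)
    {FF : Filter F} (u : T -> R) (c : R) :
  (forall e, 0 < e -> exists v, exists c',
    [/\ v x @[x --> F] --> c', (forall x, `|v x - u x| <= e) & `|c' - c| <= e]) ->
  u x @[x --> F] --> c.
Proof.
move=> H; apply/cvgrPdist_le => e e0.
have e30 : 0 < e / 3 by rewrite divr_gt0.
have [v [c' [vc vu cc]]] := H _ e30.
move/cvgrPdist_le : vc => /(_ _ e30); apply: filterS => x vx.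
move: (vu x) cc vx; rewrite !ler_norml => /andP[? ?] /andP[? ?] /andP[? ?].
by lra.
Qed.

Section stability.
Context (R : realType) (Phi : R -> R -> R) (h : R -> R) (lambda : R).
Context (nu : probability R R) d (Omega : measurableType d).
Context (P : probability Omega R) (E zeta : nat -> {RV P >-> R}).
Hypothesis driver : income_driver lambda nu E zeta.
Hypothesis model : jump_model Phi h lambda (distribution P (E 0%N)).
Local Open Scope ereal_scope.
Implicit Types (f : R -> \bar R) (phi psi : probability R R).

Local Notation U f := (income_op Phi h lambda (distribution P (E 0%N)) nu f).
Local Notation Pt := (income_transition P Phi h E zeta).

Definition random_start_path t (p : R * Omega) : R :=
  log_income Phi h E zeta (cst p.1) t p.2.

Lemma measurable_random_start_path t : (0 <= t)%R ->
  measurable_fun setT (random_start_path t).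
Proof.
move=> t0.
have js n (x : R) w : jump_state Phi h (fun n (p : R * Omega) => E n p.2)
    (fun n (p : R * Omega) => zeta n p.2) fst n (x, w) =
    jump_state Phi h E zeta (cst x) n w.
  by elim: n => //= n ->.
rewrite (_ : random_start_path t = log_income Phi h
  (fun n (p : R * Omega) => E n p.2) (fun n (p : R * Omega) => zeta n p.2) fst t).
  apply: (measurable_log_income (measurable_Phi model) (h_homo model)) => //.
  - by move=> n [x w]; exact: waiting_ge0 driver n w.
  - by move=> n; exact: measurableT_comp.
  - by move=> n; exact: measurableT_comp.
by apply/funext => -[x w]; rewrite /random_start_path /log_income js.
Qed.

(** With a random start, the process lives on the product of the line and [Omega];
    the equality holds for all sets, measurable or not, which makes [right_action] a
    measure. *)
Lemma right_actionE t phi :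
  right_action Pt t phi = pushforward (phi \x P) (random_start_path t).
Proof.
apply/funext => B; apply: eq_integral => x _; congr (P _).
by apply/seteqP; split => w; rewrite /xsection /= in_setE.
Qed.

Lemma integral_right_action t phi f : (0 <= t)%R -> nneg_mfun f ->
  \int[right_action Pt t phi]_x f x = \int[phi]_x U f (x, t).
Proof.
move=> t0 fm; have mX := measurable_random_start_path t0; have [mf f0] := fm.
rewrite right_actionE ge0_integral_pushforward//= preimage_setT.
rewrite (fubini_tonelli1 (f \o random_start_path t)) => [||p]; last 2 first.
- exact: measurableT_comp.
- exact: f0.
by apply: eq_integral => x _; exact: (integral_log_income driver model x t0 fm).
Qed.

Variable k : R.
Hypotheses (k_ge0 : (0 <= k)%R) (k_lt1 : (k < 1)%R).
(** The one quantitative fact about the dynamics that the conclusion rests on: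
    [P_t f] converges uniformly to a constant, at a rate independent of [f]. *)
Hypothesis op_limit : forall f, nneg_mfun f ->
  {homo f : x y / (x <= y)%R >-> x <= y} -> (forall x, f x <= 1) ->
  exists L : R, forall n t x, (n%:R <= t)%R ->
    (L - k ^+ n)%:E <= U f (x, t) <= (L + k ^+ n)%:E.

Definition ray (a : R) (x : R) : \bar R := (\1_(`]a, +oo[%classic) x)%:E.

Lemma nneg_mfun_ray a : nneg_mfun (ray a).
Proof.
split=> [|x]; last by rewrite lee_fin.
exact/measurable_EFinP/measurable_indic.
Qed.

Lemma ray_homo a : {homo ray a : x y / (x <= y)%R >-> x <= y}.
Proof.
move=> x y xy; rewrite lee_fin !indicE ler_nat.
case: (boolP (x \in _)) => //; rewrite inE /= in_itv/= andbT => ax.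
by rewrite mem_set//= in_itv/= andbT (lt_le_trans ax).
Qed.

Lemma ray_le1 a x : ray a x <= 1.
Proof. by rewrite lee_fin indicE; case: (_ \in _). Qed.

Lemma integral_ray d' (T : measurableType d') (m : probability T R) (X : T -> R) a :
  measurable_fun setT X -> \int[m]_w ray a (X w) = m (X @^-1` `]a, +oo[).
Proof.
move=> mX; have mXa : measurable (X @^-1` `]a, +oo[%classic).
  by rewrite -[X in measurable X]setTI; exact: mX.
by rewrite -[_ @^-1` _]setIT -integral_indic//; apply: eq_integral => w _.
Qed.

Lemma pow_lt (e : R) : (0 < e)%R -> exists n, (k ^+ n < e)%R.
Proof.
move=> e0; have k1 : (`|k| < 1)%R by rewrite ger0_norm.
by have [n] := expr_lt_eventually 1 k1 e0; rewrite mul1r; exists n.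
Qed.

Definition path_rv x t (t0 : (0 <= t)%R) : {RV P >-> R} :=
  mfun_of (measurable_log_income (measurable_Phi model) (h_homo model)
    (waiting_ge0 driver) (fun n => @measurable_funPT _ _ _ _ (E n))
    (fun n => @measurable_funPT _ _ _ _ (zeta n)) (measurable_cst x) t0).

Lemma ccdf_path x t (t0 : (0 <= t)%R) a :
  ccdf (path_rv x t0) a = U (ray a) (x, t).
Proof.
rewrite -(integral_log_income driver model x t0 (nneg_mfun_ray a)).
rewrite integral_ray//; exact: (measurable_funPT (path_rv x t0)).
Qed.

(** The distribution functions of [X_n] started at [0] converge uniformly, by
    [op_limit] for rays, and a uniform limit of distribution functions is one. *)
Lemma exists_limit_law : exists phis : probability R R,
  forall a n t x, (n%:R <= t)%R ->
    phis `]a, +oo[%classic <= U (ray a) (x, t) + (k ^+ n)%:E /\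
    U (ray a) (x, t) <= phis `]a, +oo[%classic + (k ^+ n)%:E.
Proof.
have /choice[tail tailP] a := op_limit (nneg_mfun_ray a) (@ray_homo a) (ray_le1 a).
pose X (n : nat) := path_rv 0%R (ler0n R n).
pose c n a := fine (ccdf (X n) a).
have cE n a : (c n a)%:E = U (ray a) (0%R, n%:R).
  by rewrite /c fineK ?fin_num_measure// ccdf_path.
have ct n a : (`|c n a - tail a| <= k ^+ n)%R.
  have := tailP a n _ 0%R (lexx n%:R); rewrite -cE !lee_fin => /andP[u v].
  by rewrite ler_norml; apply/andP; split; lra.
pose F a := (1 - tail a)%R.
have cF n a : (`|(1 - c n a) - F a| <= k ^+ n)%R.
  have -> : (1 - c n a - F a = - (c n a - tail a))%R by rewrite /F; ring.
  by rewrite normrN.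
have unif (G : set_system R) (FG : Filter G) (b : nat -> R) (b' : R) :
    (forall n, (1 - c n x)%R @[x --> G] --> b n) ->
    (forall n, (`|b n - b'| <= k ^+ n)%R) -> F x @[x --> G] --> b'.
  move=> cb bb; apply: cvg_uniform_approx => e e0.
  have [n kn] := pow_lt e0; exists (fun x => 1 - c n x)%R, (b n).
  split => [//|x|]; last exact: le_trans (bb n) (ltW kn).
  exact: le_trans (cF n _) (ltW kn).
have cfine n (G : set_system R) (FG : ProperFilter G) (b : R) :
    ccdf (X n) x @[x --> G] --> b%:E -> (1 - c n x)%R @[x --> G] --> (1 - b)%R.
  by move=> cb; apply: cvgB; [exact: cvg_cst|exact: fine_cvg].
have [] := @probability_of_cdf R F.
- move=> a b ab; apply/ler_addgt0Pr => e e0.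
  have [n kn] := @pow_lt (e / 2) ltac:(by rewrite divr_gt0).
  have cab : (c n b <= c n a)%R.
    by rewrite -lee_fin !cE -!ccdf_path//; exact: ccdf_nonincreasing.
  move: (cF n a) (cF n b); rewrite !ler_norml => /andP[? ?] /andP[? ?].
  by lra.
- move=> a; apply: (unif _ _ (fun n => 1 - c n a)%R) => // n.
  apply: cfine; rewrite /c fineK ?fin_num_measure//.
  exact: ccdf_right_continuous.
- apply: (unif _ _ (fun=> (1 - 1)%R)) => n.
    by apply: cfine; exact: cvg_ccdfNy1.
  by rewrite subrr subr0 normr0 exprn_ge0.
- apply: (unif _ _ (fun=> (1 - 0)%R)) => n.
    by apply: cfine; exact: cvg_ccdfy0.
  by rewrite subr0 subrr normr0 exprn_ge0.
move=> phis phisF; exists phis => a n t x nt.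
have -> : phis `]a, +oo[%classic = (tail a)%:E.
  have -> : phis `]a, +oo[%classic = 1 - phis `]-oo, a]%classic.
    by rewrite -setCitvl; exact: probability_setC.
  by rewrite phisF -EFinB /F; congr EFin; ring.
have /andP[u v] := tailP a n t x nt.
by rewrite -EFinD; split => //; rewrite -leeBlDr// -EFinB.
Qed.

Lemma integral_bounds phi f (a b : R) : nneg_mfun f ->
  (forall x, a%:E <= f x <= b%:E) -> a%:E <= \int[phi]_x f x <= b%:E.
Proof.
move=> fm fab; have [mf f0] := fm.
have fa x : a%:E <= f x by case/andP: (fab x).
have fb x : f x <= b%:E by case/andP: (fab x).
have b0 : (0 <= b)%R by rewrite -lee_fin (le_trans (f0 0%R)).
have cm (c : R) : (0 <= c)%R -> nneg_mfun (cst c%:E : R -> \bar R).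
  by move=> c0; split => // x; rewrite lee_fin.
apply/andP; split; last first.
  by rewrite -(integral_probability_cst phi b); exact: (le_nneg_integral phi fm (cm b b0)).
have [a0|a0] := leP 0%R a; last first.
  by apply: (@le_trans _ _ 0); [rewrite lee_fin ltW|exact: integral_ge0].
by rewrite -(integral_probability_cst phi a); exact: (le_nneg_integral phi (cm a a0) fm).
Qed.

Lemma eq_of_pow_bounds (x : \bar R) (L : R) :
  (forall n, (L - k ^+ n)%:E <= x <= (L + k ^+ n)%:E) -> x = L%:E.
Proof.
case: x => [x| |] H; try by have /andP[] := H 0%N.
congr EFin; apply/eqP; rewrite eq_le; apply/andP; split.
  apply/ler_addgt0Pr => e /pow_lt[n kn]; have := H n.
  by rewrite !lee_fin => /andP[? ?]; lra.
apply/ler_addgt0Pr => e /pow_lt[n kn]; have := H n.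
by rewrite !lee_fin => /andP[? ?]; lra.
Qed.

Lemma nneg_mfun_op f t : nneg_mfun f -> nneg_mfun (fun x => U f (x, t)).
Proof.
move=> fm; apply: (nneg_mfun_comp (nneg_mfun_income_op nu model fm)).
exact: measurable_pair2.
Qed.

Lemma right_action_ray t phi a : (0 <= t)%R ->
  right_action Pt t phi `]a, +oo[%classic = \int[phi]_x U (ray a) (x, t).
Proof.
move=> t0; apply: eq_integral => x _.
by rewrite -(ccdf_path x t0).
Qed.

(** Equality with a probability need only be checked on open rays. *)
Lemma right_action_rays t phi psi : (0 <= t)%R ->
  (forall a, right_action Pt t phi `]a, +oo[%classic = psi `]a, +oo[%classic) ->
  forall B, measurable B -> right_action Pt t phi B = psi B.
Proof.
move=> t0; rewrite right_actionE => H B mB.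
pose m := measure_function_pushforward__canonical__measure_function_Measure
  (phi \x P) (measurable_random_start_path t0).
apply/esym; apply: (@eq_measure_rays _ psi m) => // [a|]; first exact/esym/H.
by rewrite -ge0_fin_numE ?fin_num_measure.
Qed.

Lemma integral_stationary psi t f : stationary Pt psi -> (0 <= t)%R ->
  nneg_mfun f -> \int[psi]_x f x = \int[psi]_x U f (x, t).
Proof.
move=> spsi t0 fm; rewrite -integral_right_action//.
pose m := measure_function_pushforward__canonical__measure_function_Measure
  (psi \x P) (measurable_random_start_path t0).
transitivity (\int[m]_x f x); last by rewrite right_actionE.
apply: eq_measure_integral => A mA _; have := spsi t t0 A mA.
by rewrite right_actionE => /esym.
Qed.

(** The integral of [f] against [psi] is that of [P_n f], for all [n]. *)
Lemma stationary_integral psi f (L : R) : stationary Pt psi -> nneg_mfun f ->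
  (forall n t x, (n%:R <= t)%R ->
    (L - k ^+ n)%:E <= U f (x, t) <= (L + k ^+ n)%:E) ->
  \int[psi]_x f x = L%:E.
Proof.
move=> spsi fm HL; apply: eq_of_pow_bounds => n.
rewrite (integral_stationary spsi (ler0n R n) fm).
by apply: integral_bounds => [|x]; [exact: nneg_mfun_op|exact: HL].
Qed.

Lemma stationary_unique psi1 psi2 : stationary Pt psi1 -> stationary Pt psi2 ->
  forall B, measurable B -> psi1 B = psi2 B.
Proof.
move=> s1 s2; apply: eq_measure_rays => [a|]; last first.
  by rewrite -ge0_fin_numE ?fin_num_measure.
have [L HL] := op_limit (nneg_mfun_ray a) (@ray_homo a) (ray_le1 a).
have rE psi : stationary Pt psi -> psi `]a, +oo[%classic = L%:E.
  move=> spsi; rewrite -(stationary_integral spsi (nneg_mfun_ray a) HL).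
  by rewrite /ray integral_indic// setIT.
by apply: (etrans (rE _ s1)); exact/esym/rE.
Qed.

Section limit_law.
Variable phis : probability R R.
Hypothesis phisP : forall a n t x, (n%:R <= t)%R ->
    phis `]a, +oo[%classic <= U (ray a) (x, t) + (k ^+ n)%:E /\
    U (ray a) (x, t) <= phis `]a, +oo[%classic + (k ^+ n)%:E.

(** [P_n f] at 0 is the integral of [f] against the law of [X_n] started at 0, which
    is close to [phis] on rays, hence on increasing functions. *)
Lemma limit_law_integral f n : nneg_mfun f ->
  {homo f : x y / (x <= y)%R >-> x <= y} -> (forall x, f x <= 1) ->
  \int[phis]_x f x <= U f (0%R, n%:R) + (k ^+ n)%:E /\
  U f (0%R, n%:R) <= \int[phis]_x f x + (k ^+ n)%:E.
Proof.
move=> fm f_homo f1; have [mf f0] := fm.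
have n0 : (0 <= n%:R :> R)%R by [].
pose X := path_rv 0%R n0.
have fX : \int[distribution P X]_x f x = U f (0%R, n%:R).
  rewrite ge0_integral_distribution//.
  exact: (integral_log_income driver model 0%R n0 fm).
have fE x : f x = (fine (f x))%:E.
  by rewrite fineK// ge0_fin_numE// (le_lt_trans (f1 x))// ltry.
have u_homo : {homo (fun x => fine (f x)) : x y / (x <= y)%R}.
  by move=> x y xy; rewrite -lee_fin -!fE f_homo.
have u01 x : (0 <= fine (f x) <= 1)%R by rewrite -!lee_fin -fE f0 f1.
have kn0 : (0 <= k ^+ n)%R by rewrite exprn_ge0.
have XE a : distribution P X `]a, +oo[%classic = U (ray a) (0%R, n%:R).
  exact: ccdf_path.
have close a : phis `]a, +oo[%classic <= distribution P X `]a, +oo[%classic + (k ^+ n)%:E /\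
    distribution P X `]a, +oo[%classic <= phis `]a, +oo[%classic + (k ^+ n)%:E.
  by have := phisP a 0%R (lexx n%:R); rewrite -XE.
have fI (m : {measure set R -> \bar R}) : \int[m]_x f x = \int[m]_x (fine (f x))%:E.
  by apply: eq_integral => x _.
rewrite -fX !fI; split; apply: le_integral_homo => // a.
  by case: (close a).
by case: (close a).
Qed.

(** On a ray, both measures are within multiples of [k ^ n] of [P_(n + t) f] at 0:
    the image of [phis] because [P_t f] is again increasing, [phis] itself because
    [n + t >= n]. *)
Lemma limit_law_stationary : stationary Pt phis.
Proof.
move=> t t0; apply: right_action_rays => // a; rewrite right_action_ray//.
set I := \int[phis]_x _; set r := phis _.
have Um := nneg_mfun_op t (nneg_mfun_ray a).
have U_homo := income_op_homo nu model t (nneg_mfun_ray a) (@ray_homo a).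
have U1 y : U (ray a) y <= 1.
  by apply: (income_op_le nu model (nneg_mfun_ray a)) => // x; exact: ray_le1.
have close n : I <= r + (k ^+ n + k ^+ n)%:E /\ r <= I + (k ^+ n + k ^+ n)%:E.
  have [lo hi] := limit_law_integral n Um U_homo (fun x => U1 (x, t)).
  have nt : (n%:R <= n%:R + t)%R by rewrite lerDl.
  have [plo phi_] := phisP a 0%R nt.
  have e : U (fun x => U (ray a) (x, t)) (0%R, n%:R) = U (ray a) (0%R, (n%:R + t)%R).
    by rewrite (income_op_semigroup nu model 0%R (nneg_mfun_ray a) ler01 (ray_le1 a)).
  rewrite e in lo hi; split; rewrite EFinD addeA.
    by apply: (le_trans lo); rewrite leeD2r.
  by apply: (le_trans plo); rewrite leeD2r.
apply/eqP; rewrite eq_le; apply/andP; split; apply/lee_addgt0Pr => e e0;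
  have [n kn] := @pow_lt (e / 2)%R ltac:(by rewrite divr_gt0);
  have [lo hi] := close n.
- by apply: (le_trans lo); rewrite leeD2l// lee_fin; lra.
- by apply: (le_trans hi); rewrite leeD2l// lee_fin; lra.
Qed.

End limit_law.

(** This reduces the functions with [|f| <= 1] in [beta] to functions with values in
    [`[0, 1]], which have nonnegative integrals. *)
Lemma integral_half_shift (m : {measure set R -> \bar R}) (f : R -> R) :
  m setT = 1 -> {homo f : x y / (x <= y)%R} -> (forall x, `|f x| <= 1)%R ->
  \int[m]_x (f x)%:E = 2%:E * \int[m]_x ((f x + 1) / 2)%:E - 1.
Proof.
move=> m1 f_homo f1.
have mf : measurable_fun setT f by exact: nondecreasing_measurable.
have fi : m.-integrable setT (EFin \o f).
  apply: measurable_bounded_integrable => //.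
    by change (m setT < +oo); rewrite m1 ltry.
  by exists 1%R; split => // M M1 x _; exact: le_trans (f1 x) (ltW M1).
have oi : m.-integrable setT (EFin \o cst 1%R).
  apply: measurable_bounded_integrable => //.
    by change (m setT < +oo); rewrite m1 ltry.
  by exists 1%R; split => // M M1 x _ /=; rewrite (@normr1 R) ltW.
have <- : \int[m]_x (f x + 1)%:E = 2%:E * \int[m]_x ((f x + 1) / 2)%:E.
  rewrite -ge0_integralZl_EFin//.
  - by apply: eq_integral => x _; rewrite -EFinM; congr EFin; field.
  - move=> x _; rewrite lee_fin divr_ge0// -lerBlDr sub0r.
    by have := f1 x; rewrite ler_norml => /andP[].
  - by apply/measurable_EFinP/measurable_funM => //; exact: measurable_funD.
have -> : \int[m]_x (f x + 1)%:E = \int[m]_x (f x)%:E + 1.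
  rewrite -[in RHS]m1 -[X in _ = _ + X]mul1e -integral_cst//.
  by rewrite -integralD_EFin.
by rewrite addeK.
Qed.

Lemma right_action_setT t phi : (0 <= t)%R -> right_action Pt t phi setT = 1.
Proof.
move=> t0; rewrite /right_action -[RHS](integral_probability_cst phi).
by apply: eq_integral => x _; exact: probability_setT.
Qed.

(** The image of [phi] integrates [P_t f], which is within [k ^ n] of the limit [L],
    and [phis] integrates [f] to [L]; the factor 2 comes from rescaling [f]. *)
Lemma beta_le phis phi n t : stationary Pt phis -> (n%:R <= t)%R ->
  beta (right_action Pt t phi) phis <= (2 * k ^+ n)%:E.
Proof.
move=> sphis nt; have t0 : (0 <= t)%R by exact: le_trans nt.
apply: ge_ereal_sup => _ [f [f_homo f1] <-].
pose u x : \bar R := ((f x + 1) / 2)%:E.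
have f11 x : (-1 <= f x <= 1)%R by have := f1 x; rewrite ler_norml.
have um : nneg_mfun u.
  have mf : measurable_fun setT f by exact: nondecreasing_measurable.
  split=> [|x].
    by apply/measurable_EFinP/measurable_funM => //; exact: measurable_funD.
  by rewrite lee_fin divr_ge0// -lerBlDr sub0r; case/andP: (f11 x).
have u_homo : {homo u : x y / (x <= y)%R >-> x <= y}.
  by move=> x y xy; rewrite lee_fin ler_pM2r// lerD2r f_homo.
have u1 x : u x <= 1.
  by rewrite lee_fin ler_pdivrMr// mul1r -[leRHS]/(1 + 1)%R lerD2r; case/andP: (f11 x).
have [L HL] := op_limit um u_homo u1.
pose m := measure_function_pushforward__canonical__measure_function_Measure
  (phi \x P) (measurable_random_start_path t0).
have mE : right_action Pt t phi = m by exact: right_actionE.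
have m1 : m setT = 1 by rewrite -mE right_action_setT.
have Im : (L - k ^+ n)%:E <= \int[m]_x u x <= (L + k ^+ n)%:E.
  rewrite -mE integral_right_action//; apply: integral_bounds => [|x].
    exact: nneg_mfun_op.
  exact: HL.
have fm : \int[m]_x (f x)%:E = 2%:E * \int[m]_x u x - 1.
  exact: integral_half_shift.
have fphis : \int[phis]_x (f x)%:E = 2%:E * \int[phis]_x u x - 1.
  by apply: integral_half_shift => //; exact: probability_setT.
rewrite mE fm fphis (stationary_integral sphis um HL).
move: Im; case: (\int[m]_x u x) => [r| |].
- rewrite !lee_fin => /andP[r1 r2].
  by rewrite ler_norml; apply/andP; split; lra.
- by case/andP.
- by case/andP.
Qed.

Lemma beta_cvg phis phi : stationary Pt phis ->
  beta (right_action Pt t phi) phis @[t --> +oo%R] --> 0.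
Proof.
move=> sphis.
have b0 t : 0 <= beta (right_action Pt t phi) phis.
  apply: (@le_trans _ _ (`|\int[right_action Pt t phi]_x (cst 0%R x : R)%:E -
    \int[phis]_x (cst 0%R x : R)%:E|)); first exact: abse_ge0.
  apply: ereal_sup_ubound; exists (cst 0%R) => //.
  by split => [x y _ //|x]; rewrite normr0.
have bfin n t : (n%:R <= t)%R ->
    (fine (beta (right_action Pt t phi) phis))%:E = beta (right_action Pt t phi) phis.
  move=> nt; rewrite fineK// ge0_fin_numE// (le_lt_trans (beta_le _ sphis nt))//.
  by rewrite ltry.
apply/fine_cvgP; split.
  near=> t; rewrite -(bfin 0%N t)//; near: t; exact: nbhs_pinfty_ge.
apply/cvgrPdist_le => e e0.
have [n kn] := @pow_lt (e / 2)%R ltac:(by rewrite divr_gt0).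
near=> t; have nt : (n%:R <= t)%R by near: t; exact: nbhs_pinfty_ge.
rewrite sub0r normrN ger0_norm ?fine_ge0// -lee_fin (bfin n)//.
apply: (le_trans (beta_le _ sphis nt)); rewrite lee_fin.
by lra.
Unshelve. all: by end_near. Qed.

Lemma income_globally_stable : globally_stable Pt.
Proof.
have [phis phisP] := exists_limit_law.
have sphis := limit_law_stationary phisP.
exists phis; split => // [psi spsi B mB|phi]; last exact: beta_cvg.
exact: stationary_unique.
Qed.

End stability.
Unset Implicit Arguments.

Theorem proposition8p1 (R : realType) (g : R -> R) (Phi : R -> R -> R)
    (g_lip : locally_lipschitz g) (Phi_flow : semiflow_of g Phi)
    (lambda : R) (lambda_gt0 : 0 < lambda) (nu : probability R R)
    (h : R -> R) (h_bounded : bounded_fun h)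
    (h_increasing : {homo h : x y / x <= y})
    (support_wide : exists a b, [/\ msupport nu a, msupport nu b &
       b - a > sup (range h) - inf (range h)])
    (d : measure_display) (Omega : measurableType d) (P : probability Omega R)
    (E zeta : nat -> {RV P >-> R}) (driver : income_driver lambda nu E zeta) :
  globally_stable (income_transition P Phi h E zeta).
Proof.
have model : jump_model Phi h lambda (distribution P (E 0%N)).
  split => //.
  - exact: measurable_flow g_lip Phi_flow.
  - exact: flowD g_lip Phi_flow.
  - exact: flow_homo g_lip Phi_flow.
  - exact: distribution_waiting_tail driver.
have [a [b [nu_a nu_b ab]]] := support_wide.
set hM := sup (range h) in ab; set hm := inf (range h) in ab.
have h_bounds x : hm <= h x <= hM.
  apply/andP; split.
    by apply: ge_inf; [exact: bounded_fun_has_lbound|exists x].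
  by apply: ub_le_sup; [exact: bounded_fun_has_ubound|exists x].
have hmM : hm <= hM by case/andP: (h_bounds 0) => /le_trans; exact.
(* this [eps] makes [hM + alpha] and [hm + beta] equal *)
pose eps := (b - a - (hM - hm)) / 2.
have eps_gt0 : 0 < eps by rewrite divr_gt0 ?subr_gt0.
pose alpha := a + eps; pose beta := b - eps.
have low_gt0 : (0 < nu `]-oo, alpha[%classic)%E.
  by apply: nu_a; split; [exact: interval_open|rewrite /= in_itv/= ltrDl].
have high_gt0 : (0 < nu `]beta, +oo[%classic)%E.
  apply: nu_b; split; first exact: interval_open.
  by rewrite /= in_itv/= andbT ltrBlDr ltrDl.
pose delta := Num.min (fine (nu `]-oo, alpha[%classic)) (fine (nu `]beta, +oo[%classic)).
have delta_gt0 : 0 < delta.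
  by rewrite lt_min !fine_gt0 ?low_gt0 ?high_gt0 ?(le_lt_trans (probability_le1 _ _)) ?ltry.
have delta_low : (delta%:E <= nu `]-oo, alpha[%classic)%E.
  by rewrite -[leRHS]fineK ?fin_num_measure// lee_fin ge_min lexx.
have delta_high : (delta%:E <= nu `]beta, +oo[%classic)%E.
  by rewrite -[leRHS]fineK ?fin_num_measure// lee_fin ge_min lexx orbT.
have delta_le : delta <= 1 by exact: delta_le1 delta_low.
have alpha_eps : hM + alpha <= hM + a + eps by rewrite addrA.
have beta_eps : hM + a + eps <= hm + beta by rewrite /beta /eps; lra.
have alpha_beta : alpha <= beta by rewrite /alpha /beta /eps; lra.
have contraction := shock_contraction alpha_eps beta_eps alpha_beta delta_low delta_high.
apply: (income_globally_stable driver model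
  (contraction_rate_ge0 lambda_gt0 delta_le)
  (contraction_rate_lt1 lambda_gt0 delta_gt0)).
move=> f fm f_homo f1.
exact: (income_op_limit model lambda_gt0 h_bounds delta_le contraction
  fm f_homo f1).
Qed.
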